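(* Let $\langle A(t)\rangle_{t\in X}$ be a continuous field of C*-algebras over a locally compact Hausdorff space $X$ such that each fiber $A(t)$ is separable and inner quasidiagonal. Then the C*-algebra $A$ of continuous sections of the field vanishing at infinity is inner quasidiagonal.
   Context: Inner quasidiagonal: a C*-algebra $A$ is inner quasidiagonal if for every $x_1,\dots,x_n\in A$ and $\epsilon>0$ there are a representation $\pi$ of $A$ on a Hilbert space $\mathcal{H}$ and a finite-rank projection $P\in\pi(A)''$ (the bicommutant of $\pi(A)$ in $\mathcal{L}(\mathcal{H})$) such that $\|P\pi(x_j)-\pi(x_j)P\|<\epsilon$ and $\|P\pi(x_j)P\|>\|x_j\|-\epsilon$ for $1\le j\le n$. Continuous fields of C*-algebras are in the usual (Dixmier) sense. *)

(* Defs.v *)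
From HB Require Import structures.
From mathcomp Require Import all_boot all_order all_algebra.
From mathcomp Require Import all_classical all_reals all_analysis.
From mathcomp Require Import complex.

Set Implicit Arguments.
Unset Strict Implicit.
Unset Printing Implicit Defensive.

Import Order.TTheory GRing.Theory Num.Theory.
Import numFieldNormedType.Exports.

Local Open Scope classical_set_scope.
Local Open Scope ring_scope.

(* The norm of a [normedModType R[i]] takes its values in the nonnegative reals
   of [R[i]]; [rnorm] is the same number seen in [R]. *)
Definition rnorm (R : realType) (V : normedModType R[i]) (x : V) : R :=
  complex.Re `|x|.

(* C*-algebras are not assumed to be unital, nor to be nonzero. *)
HB.mixin Record CompleteNormedModule_isCstar (R : realType) A
    & CompleteNormedModule R[i] A := {
  cmul : A -> A -> A ;
  cstar : A -> A ;
  cmulA : associative cmul ;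
  cmulDl : left_distributive cmul +%R ;
  cmulDr : right_distributive cmul +%R ;
  cmulZl : forall (l : R[i]) (x y : A), cmul (l *: x) y = l *: cmul x y ;
  cmulZr : forall (l : R[i]) (x y : A), cmul x (l *: y) = l *: cmul x y ;
  cstarD : {morph cstar : x y / x + y} ;
  cstarZ : forall (l : R[i]) (x : A), cstar (l *: x) = l^* *: cstar x ;
  cstarM : forall x y : A, cstar (cmul x y) = cmul (cstar y) (cstar x) ;
  cstarK : involutive cstar ;
  norm_cmul_le : forall x y : A, `|cmul x y| <= `|x| * `|y| ;
  norm_cstar : forall x : A, `|cmul (cstar x) x| = `|x| ^+ 2
}.

#[short(type="cstarType")]
HB.structure Definition Cstar (R : realType) :=
  {A of CompleteNormedModule R[i] A & CompleteNormedModule_isCstar R A}.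

(* The inner product is linear in its first argument. *)
HB.mixin Record CompleteNormedModule_isHilbert (R : realType) H
    & CompleteNormedModule R[i] H := {
  inner : H -> H -> R[i] ;
  inner_linearl : forall (l : R[i]) (x y z : H),
    inner (l *: x + y) z = l * inner x z + inner y z ;
  inner_conj : forall x y : H, inner y x = (inner x y)^* ;
  inner_norm : forall x : H, inner x x = `|x| ^+ 2
}.

#[short(type="hilbertType")]
HB.structure Definition Hilbert (R : realType) :=
  {H of CompleteNormedModule R[i] H & CompleteNormedModule_isHilbert R H}.

Section operators.
Context {R : realType} {H : hilbertType R}.

Definition bounded_operator : set (H -> H) :=
  [set T | linear T /\ continuous T].

(* Only meaningful for bounded operators ([sup] is 0 on an unbounded set). *)
Definition opnorm (T : H -> H) : R :=
  sup [set rnorm (T x) | x in [set x : H | rnorm x <= 1]].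

Definition commutant (S : set (H -> H)) : set (H -> H) :=
  [set T | bounded_operator T /\ forall U, S U -> T \o U = U \o T].

Definition bicommutant (S : set (H -> H)) : set (H -> H) :=
  commutant (commutant S).

Definition projection (P : H -> H) : Prop :=
  [/\ bounded_operator P, P \o P = P &
      forall x y, inner (P x) y = inner x (P y)].

Definition finite_rank (T : H -> H) : Prop :=
  exists (n : nat) (e : 'I_n -> H),
    forall x, exists c : 'I_n -> R[i], T x = \sum_(i < n) c i *: e i.

End operators.

(* Representations may be degenerate, and [H] may be zero. *)
Definition representation (R : realType) (A : cstarType R) (H : hilbertType R)
    (pi : A -> H -> H) : Prop :=
  [/\ forall a, bounded_operator (pi a),
      linear pi,
      forall a b, pi (cmul a b) = pi a \o pi b &
      forall a x y, inner (pi a x) y = inner x (pi (cstar a) y)].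

Definition inner_quasidiagonal (R : realType) (A : cstarType R) : Prop :=
  forall (n : nat) (x : 'I_n -> A) (eps : R), 0 < eps ->
  exists (H : hilbertType R) (pi : A -> H -> H) (P : H -> H),
    [/\ representation pi,
        projection P,
        finite_rank P,
        bicommutant (range pi) P &
        forall j,
          opnorm ((P \o pi (x j)) \- (pi (x j) \o P)) < eps /\
          rnorm (x j) - eps < opnorm (P \o pi (x j) \o P)].

Definition separable_space (T : topologicalType) : Prop :=
  exists2 D : set T, countable D & dense D.

(* Dixmier, C*-algebras, Definitions 10.1.2 and 10.3.1. *)
Record continuous_field (R : realType) (X : topologicalType)
    (A : X -> cstarType R) := ContinuousField {
  field_section :> set (forall t, A t) ;
  field0 : field_section (fun=> 0) ;
  fieldD : forall x y, field_section x -> field_section y ->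
    field_section (fun t => x t + y t) ;
  fieldZ : forall (l : R[i]) x, field_section x ->
    field_section (fun t => l *: x t) ;
  fieldM : forall x y, field_section x -> field_section y ->
    field_section (fun t => cmul (x t) (y t)) ;
  field_star : forall x, field_section x ->
    field_section (fun t => cstar (x t)) ;
  field_dense : forall t, dense [set x t | x in field_section] ;
  field_continuous : forall x, field_section x ->
    continuous (fun t => rnorm (x t)) ;
  field_local : forall x : forall t, A t,
    (forall (t : X) (e : R), 0 < e -> exists2 y, field_section y &
       \forall s \near t, rnorm (x s - y s) <= e) ->
    field_section x
}.

Definition vanishes_at_infinity (R : realType) (X : topologicalType)
    (A : X -> cstarType R) (x : forall t, A t) : Prop :=
  forall e : R, 0 < e ->
  exists2 K : set X, compact K & forall t, ~ K t -> rnorm (x t) < e.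

Record c0_section (R : realType) (X : topologicalType) (A : X -> cstarType R)
    (F : continuous_field A) := C0Section {
  c0_val :> forall t, A t ;
  c0_valP : field_section F c0_val ;
  c0_val_vanish : vanishes_at_infinity c0_val
}.

Section rnorm_theory.
Context {R : realType} {V : normedModType R[i]}.
Implicit Types x y : V.

Lemma rnormE x : `|x| = (rnorm x)%:C%C.
Proof.
have /complex_realP[k xk] : `|x| \is Num.real by rewrite normr_real.
by rewrite /rnorm xk.
Qed.

Lemma rnorm_ge0 x : 0 <= rnorm x.
Proof. by rewrite -lecR -rnormE normr_ge0. Qed.

Lemma rnormD x y : rnorm (x + y) <= rnorm x + rnorm y.
Proof. by rewrite -lecR rmorphD/= -!rnormE ler_normD. Qed.

Lemma rnormZ (l : R[i]) x : rnorm (l *: x) = complex.Re `|l| * rnorm x.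
Proof.
by apply: complexI; rewrite -rnormE normrZ rmorphM/= -rnormE; congr (_ * _).
Qed.

Lemma rnorm0 : rnorm (0 : V) = 0.
Proof. by rewrite /rnorm normr0. Qed.

Lemma rnorm0_eq0 x : rnorm x = 0 -> x = 0.
Proof. by move=> x0; apply/eqP; rewrite -normr_eq0 rnormE x0. Qed.

Lemma rnormN x : rnorm (- x) = rnorm x.
Proof. by rewrite /rnorm normrN. Qed.

Lemma rdistC x y : rnorm (x - y) = rnorm (y - x).
Proof. by rewrite /rnorm distrC. Qed.

End rnorm_theory.

Section c0_theory.
Context {R : realType} {X : topologicalType} {A : X -> cstarType R}
  {F : continuous_field A}.
Local Notation C0 := (c0_section F).
Implicit Types (x y z : C0) (l : R[i]).

Lemma c0P x y : (forall t, x t = y t) -> x = y.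
Proof.
case: x y => x xF x0 [y yF y0] /= xy.
have {}xy : x = y by apply: functional_extensionality_dep.
by subst y; congr C0Section; exact: Prop_irrelevance.
Qed.

HB.instance Definition _ := gen_eqMixin C0.
HB.instance Definition _ := gen_choiceMixin C0.

Lemma vanishes_le (u v : forall t, A t) (c : R) :
  vanishes_at_infinity v -> (forall t, rnorm (u t) <= c * rnorm (v t)) ->
  vanishes_at_infinity u.
Proof.
move=> v0 uv e e0; have c0 : 0 < `|c| + 1 by rewrite ltr_pwDr.
have [|K cK Kv] := v0 (e / (`|c| + 1)); first exact: divr_gt0.
exists K => // t /Kv; rewrite ltr_pdivlMr// => vt.
apply: le_lt_trans (uv t) (le_lt_trans _ vt).
rewrite mulrC ler_wpM2l ?rnorm_ge0// (le_trans (ler_norm _))//.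
by rewrite lerDl.
Qed.

Lemma vanishes_add (u v : forall t, A t) : vanishes_at_infinity u ->
  vanishes_at_infinity v -> vanishes_at_infinity (fun t => u t + v t).
Proof.
move=> u0 v0 e e0.
have [|K cK Ku] := u0 (e / 2); first exact: divr_gt0.
have [|L cL Lv] := v0 (e / 2); first exact: divr_gt0.
exists (K `|` L); first exact: compactU.
move=> t /= /not_orP[/Ku ut /Lv vt].
by apply: le_lt_trans (rnormD _ _) _; rewrite (splitr e) ltrD.
Qed.

Lemma c0_bounded x : exists c : R, forall t, rnorm (x t) <= c.
Proof.
have [K cK Kx] := c0_val_vanish x ltr01.
have := field_continuous (c0_valP x).
set f := fun t => _ => cf.
have : compact (f @` K).
  by apply: continuous_compact => //; apply: continuous_subspaceT.
move=> /compact_bounded[M [_ /(_ (M + 1))]]; rewrite ltrDl => /(_ ltr01) MK.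
exists (Num.max (M + 1) 1) => t; rewrite le_max.
have [Kt|/Kx/ltW ->] := pselect (K t); last by rewrite orbT.
by rewrite (le_trans (ler_norm _))// MK//; exists t.
Qed.

Definition c0_zero : C0.
Proof.
exists (fun=> 0); first exact: field0.
by move=> e e0; exists set0 => [|t _]; [exact: compact0|rewrite rnorm0].
Defined.

Definition c0_add x y : C0.
Proof.
exists (fun t => x t + y t); first by apply: fieldD; exact: c0_valP.
by apply: vanishes_add; exact: c0_val_vanish.
Defined.

Definition c0_scale l x : C0.
Proof.
exists (fun t => l *: x t); first by apply: fieldZ; exact: c0_valP.
by apply: vanishes_le (c0_val_vanish x) _ => t; rewrite rnormZ.
Defined.

Definition c0_opp x : C0.
Proof.
exists (fun t => - x t).
  rewrite (_ : (fun t => _) = (fun t => (-1) *: x t)).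
    by apply: fieldZ; exact: c0_valP.
  by apply: functional_extensionality_dep => t; rewrite scaleN1r.
apply: (vanishes_le (c := 1)) (c0_val_vanish x) _ => t.
by rewrite rnormN mul1r.
Defined.

Lemma rnormM (t : X) (a b : A t) : rnorm (cmul a b) <= rnorm a * rnorm b.
Proof. by rewrite -lecR rmorphM/= -!rnormE norm_cmul_le. Qed.

Definition c0_mul x y : C0.
Proof.
exists (fun t => cmul (x t) (y t)).
  by apply: fieldM; exact: c0_valP.
have [c xc] := c0_bounded x.
apply: (vanishes_le (c := c)) (c0_val_vanish y) _ => t.
by rewrite (le_trans (rnormM _ _))// ler_wpM2r ?rnorm_ge0.
Defined.

Lemma rnorm_starM (t : X) (a : A t) :
  rnorm (cmul (cstar a) a) = rnorm a ^+ 2.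
Proof. by apply: complexI; rewrite -rnormE norm_cstar rmorphXn/= -rnormE. Qed.

Lemma rnorm_star (t : X) (a : A t) : rnorm (cstar a) = rnorm a.
Proof.
have le (b : A t) : rnorm b <= rnorm (cstar b).
  have := rnormM (cstar b) b; rewrite rnorm_starM expr2.
  have [->|b0] := eqVneq (rnorm b) 0; first by rewrite rnorm_ge0.
  by rewrite ler_pM2r// lt_neqAle eq_sym b0 rnorm_ge0.
by apply/eqP; rewrite eq_le le andbT -{2}(cstarK a) le.
Qed.

Definition c0_star x : C0.
Proof.
exists (fun t => cstar (x t)); first by apply: field_star; exact: c0_valP.
apply: (vanishes_le (c := 1)) (c0_val_vanish x) _ => t.
by rewrite rnorm_star mul1r.
Defined.

Let c0_addA : associative c0_add.
Proof. by move=> x y z; apply: c0P => t /=; rewrite addrA. Qed.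

Let c0_addC : commutative c0_add.
Proof. by move=> x y; apply: c0P => t /=; rewrite addrC. Qed.

Let c0_add0 : left_id c0_zero c0_add.
Proof. by move=> x; apply: c0P => t /=; rewrite add0r. Qed.

Let c0_addN : left_inverse c0_zero c0_opp c0_add.
Proof. by move=> x; apply: c0P => t /=; rewrite addNr. Qed.

HB.instance Definition _ :=
  GRing.isZmodule.Build C0 c0_addA c0_addC c0_add0 c0_addN.

Let c0_scaleA l m x : c0_scale l (c0_scale m x) = c0_scale (l * m) x.
Proof. by apply: c0P => t /=; rewrite scalerA. Qed.

Let c0_scale1 : left_id 1 c0_scale.
Proof. by move=> x; apply: c0P => t /=; rewrite scale1r. Qed.

Let c0_scaleDr : right_distributive c0_scale +%R.
Proof. by move=> l x y; apply: c0P => t /=; rewrite scalerDr. Qed.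

Let c0_scaleDl x : {morph c0_scale^~ x : l m / l + m}.
Proof. by move=> l m; apply: c0P => t /=; rewrite scalerDl. Qed.

HB.instance Definition _ := GRing.Zmodule_isLmodule.Build R[i] C0
  c0_scaleA c0_scale1 c0_scaleDr c0_scaleDl.

Definition c0_norm x : R := sup [set rnorm (x t) | t in setT].

Lemma c0_norm_ge x (t : X) : rnorm (x t) <= c0_norm x.
Proof.
apply: ub_le_sup; last by exists t.
by have [c xc] := c0_bounded x; exists c => _ [s _ <-].
Qed.

Lemma c0_norm_le x (c : R) : 0 <= c -> (forall t, rnorm (x t) <= c) ->
  c0_norm x <= c.
Proof.
move=> c0 xc; rewrite /c0_norm.
have [->|/set0P ne] := eqVneq [set rnorm (x t) | t in setT] set0.
  by rewrite sup0.
by apply: ge_sup => // _ [t _ <-].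
Qed.

Lemma c0_norm_ge0 x : 0 <= c0_norm x.
Proof.
rewrite /c0_norm.
have [->|/set0P[_ [t _ _]]] := eqVneq [set rnorm (x t) | t in setT] set0.
  by rewrite sup0.
exact: le_trans (rnorm_ge0 (x t)) (c0_norm_ge x t).
Qed.

Let c0_normD x y : (c0_norm (x + y))%:C%C <= (c0_norm x)%:C%C + (c0_norm y)%:C%C.
Proof.
rewrite -rmorphD/= lecR; apply: c0_norm_le => [|t].
  by rewrite addr_ge0 ?c0_norm_ge0.
by apply: le_trans (rnormD _ _) _; rewrite lerD ?c0_norm_ge.
Qed.

Lemma c0_normZ_le l x : c0_norm (l *: x) <= complex.Re `|l| * c0_norm x.
Proof.
have l0 : 0 <= complex.Re `|l| by exact: (@rnorm_ge0 _ (R[i]^o)).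
apply: c0_norm_le => [|t]; first by rewrite mulr_ge0 ?c0_norm_ge0.
by rewrite rnormZ ler_wpM2l// c0_norm_ge.
Qed.

Let c0_normZ l x : (c0_norm (l *: x))%:C%C = `|l| * (c0_norm x)%:C%C.
Proof.
have -> : `|l| = (complex.Re `|l|)%:C%C by exact: (@rnormE _ (R[i]^o)).
rewrite -rmorphM; congr (_%:C%C).
apply/eqP; rewrite eq_le c0_normZ_le andTb.
have [->|l0] := eqVneq l 0.
  by rewrite normr0 mul0r c0_norm_ge0.
have l1 : 0 < complex.Re `|l|.
  by rewrite -ltcR -(@rnormE _ (R[i]^o)) normr_gt0.
rewrite mulrC -ler_pdivlMr//.
rewrite -[in leLHS](scalerK l0 x) (le_trans (c0_normZ_le _ _))//.
rewrite mulrC ler_wpM2l ?c0_norm_ge0// normfV.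
have -> : `|l| = (complex.Re `|l|)%:C%C by exact: (@rnormE _ (R[i]^o)).
by rewrite -fmorphV.
Qed.

Let c0_norm_eq0 x : (c0_norm x)%:C%C = 0 -> x = 0.
Proof.
move=> /complexI x0; apply: c0P => t; apply: rnorm0_eq0.
by apply/eqP; rewrite eq_le rnorm_ge0 andbT -x0 c0_norm_ge.
Qed.

HB.instance Definition _ := Lmodule_isNormed.Build R[i] C0
  c0_normD c0_normZ c0_norm_eq0.

Lemma c0_normE x : `|x| = (sup [set rnorm (x t) | t in setT])%:C%C.
Proof. by []. Qed.

Lemma c0_rnormE x : rnorm x = c0_norm x.
Proof. by []. Qed.

Let posC (e : R[i]) : 0 < e -> exists2 r : R, 0 < r & e = r%:C%C.
Proof.
move=> e0; have /complex_realP[r re] : e \is Num.real by rewrite gtr0_real.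
by exists r => //; rewrite -ltcR -re.
Qed.

Let rnorm_ltP (V : normedModType R[i]) (v : V) (r : R) :
  (`|v| < r%:C%C) = (rnorm v < r).
Proof. by rewrite rnormE ltcR. Qed.

Let c0_cauchy_cvg (G : set_system C0) : ProperFilter G -> cauchy G -> cvg G.
Proof.
move=> FG cG.
have cG1 (r : R) : 0 < r -> exists y, G [set x | rnorm (y - x) < r].
  move=> r0; have /cauchyP/(_ r%:C%C) := cG.
  rewrite ltcR => /(_ r0)[y Gy]; exists y; apply: filterS Gy => x /=.
  by rewrite -ball_normE/= rnorm_ltP.
pose u t : A t := lim ((fun x : C0 => x t) @ G).
have Gu (t : X) (r : R) : 0 < r -> G [set x : C0 | rnorm (u t - x t) < r].
  move=> r0; have FGt : ProperFilter ((fun x : C0 => x t) @ G).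
    exact: fmap_proper_filter.
  have : cvg ((fun x : C0 => x t) @ G).
    apply: cauchy_cvg; apply: cauchy_exP => _ /posC[e e0 ->].
    have [y Gy] := cG1 _ e0; exists (y t).
    change (G [set x : C0 | ball (y t) e%:C%C (x t)]).
    apply: filterS Gy => x /= yx; rewrite -ball_normE/= rnorm_ltP.
    exact: le_lt_trans (c0_norm_ge (y - x) t) yx.
  move=> /cvgrPdist_lt/(_ r%:C%C); rewrite ltcR => /(_ r0).
  by apply: (@filterS _ G) => x /=; rewrite rnorm_ltP.
have Gle (y : C0) (r : R) : G [set x | rnorm (y - x) < r] ->
    forall t, rnorm (u t - y t) <= r.
  move=> Gy t; apply/ler_addgt0Pr => e e0.
  have [x [/= ux /ltW yx]] := filter_ex (filterI (Gu t e e0) Gy).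
  rewrite -(subrKA (x t)) addrC (le_trans (rnormD _ _))// lerD ?(ltW ux)//.
  by rewrite rdistC (le_trans (c0_norm_ge (y - x) t)).
have uF : field_section F u.
  apply: field_local => t e e0; have [y Gy] := cG1 _ e0.
  exists y; first exact: c0_valP.
  by apply: nearW => s; exact: Gle.
have u0 : vanishes_at_infinity u.
  move=> e e0; have e20 : 0 < e / 2 by rewrite divr_gt0.
  have [y Gy] := cG1 _ e20.
  have [K cK Ky] := c0_val_vanish y e20; exists K => // t /Ky yt.
  rewrite -(subrK (y t) (u t)) (le_lt_trans (rnormD _ _))//.
  by rewrite (splitr e) ler_ltD// Gle.
apply/cvg_ex; exists (C0Section uF u0).
apply/cvgrPdist_le => _ /posC[e e0 ->].
have e20 : 0 < e / 2 by rewrite divr_gt0.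
have [y Gy] := cG1 _ e20.
apply: filterS (Gy) => x /= yx; rewrite rnormE lecR c0_rnormE.
apply: c0_norm_le => [|t]; first exact: ltW.
rewrite [leLHS](_ : _ = rnorm ((u t - y t) + (y - x : C0) t)); last first.
  by rewrite /= addrA subrK.
rewrite (splitr e) (le_trans (rnormD _ _))// lerD ?Gle//.
by rewrite (le_trans (c0_norm_ge (y - x) t))// ltW.
Qed.

HB.instance Definition _ := Uniform_isComplete.Build C0 c0_cauchy_cvg.

Let c0_mulA : associative c0_mul.
Proof. by move=> x y z; apply: c0P => t /=; rewrite cmulA. Qed.

Let c0_mulDl : left_distributive c0_mul +%R.
Proof. by move=> x y z; apply: c0P => t /=; rewrite cmulDl. Qed.

Let c0_mulDr : right_distributive c0_mul +%R.
Proof. by move=> x y z; apply: c0P => t /=; rewrite cmulDr. Qed.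

Let c0_mulZl l x y : c0_mul (l *: x) y = l *: c0_mul x y.
Proof. by apply: c0P => t /=; rewrite cmulZl. Qed.

Let c0_mulZr l x y : c0_mul x (l *: y) = l *: c0_mul x y.
Proof. by apply: c0P => t /=; rewrite cmulZr. Qed.

Let c0_starD : {morph c0_star : x y / x + y}.
Proof. by move=> x y; apply: c0P => t /=; rewrite cstarD. Qed.

Let c0_starZ l x : c0_star (l *: x) = l^* *: c0_star x.
Proof. by apply: c0P => t /=; rewrite cstarZ. Qed.

Let c0_starM x y : c0_star (c0_mul x y) = c0_mul (c0_star y) (c0_star x).
Proof. by apply: c0P => t /=; rewrite cstarM. Qed.

Let c0_starK : involutive c0_star.
Proof. by move=> x; apply: c0P => t /=; rewrite cstarK. Qed.

Let c0_normM x y : `|c0_mul x y| <= `|x| * `|y|.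
Proof.
rewrite !rnormE -rmorphM/= lecR !c0_rnormE.
apply: c0_norm_le => [|t]; first by rewrite mulr_ge0 ?c0_norm_ge0.
by rewrite (le_trans (rnormM _ _))// ler_pM ?rnorm_ge0 ?c0_norm_ge.
Qed.

Let c0_norm_star x : `|c0_mul (c0_star x) x| = `|x| ^+ 2.
Proof.
rewrite !rnormE -rmorphXn/= !c0_rnormE; congr (_%:C%C).
apply/eqP; rewrite eq_le; apply/andP; split.
  apply: c0_norm_le => [|t]; first by rewrite sqr_ge0.
  by rewrite rnorm_starM ler_sqr ?nnegrE ?rnorm_ge0 ?c0_norm_ge0 ?c0_norm_ge.
set z := c0_mul _ _.
rewrite -[leRHS]sqr_sqrtr ?c0_norm_ge0//.
rewrite ler_sqr ?nnegrE ?sqrtr_ge0 ?c0_norm_ge0//.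
apply: c0_norm_le => [|t]; first exact: sqrtr_ge0.
rewrite -[leLHS]ger0_norm ?rnorm_ge0// -sqrtr_sqr ler_wsqrtr//.
by rewrite -rnorm_starM; exact: (c0_norm_ge z t).
Qed.

HB.instance Definition _ := CompleteNormedModule_isCstar.Build R C0
  c0_mulA c0_mulDl c0_mulDr c0_mulZl c0_mulZr c0_starD c0_starZ c0_starM
  c0_starK c0_normM c0_norm_star.

End c0_theory.

Definition c0_algebra (R : realType) (X : topologicalType)
    (A : X -> cstarType R) (F : continuous_field A) : cstarType R :=
  c0_section F.

Lemma c0_algebraE (R : realType) (X : topologicalType) (A : X -> cstarType R)
    (F : continuous_field A) (x y : c0_section F) (l : R[i]) :
  [/\ forall t, (x + y) t = x t + y t,
      forall t, (l *: x) t = l *: x t,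
      forall t, (cmul x y) t = cmul (x t) (y t),
      forall t, (cstar x) t = cstar (x t) &
      rnorm (x : c0_algebra F) = sup [set rnorm (x t) | t in [set: X]]].
Proof. by []. Qed.

(* Main.v *)
Require Import Defs.
From HB Require Import structures.
From mathcomp Require Import all_boot all_order all_algebra.
From mathcomp Require Import all_classical all_reals all_analysis.
From mathcomp Require Import complex.
From mathcomp Require Import ring lra.

Set Implicit Arguments.
Unset Strict Implicit.
Unset Printing Implicit Defensive.

Import Order.TTheory GRing.Theory Num.Theory.
Import numFieldNormedType.Exports.

Local Open Scope classical_set_scope.
Local Open Scope ring_scope.

(** Given finitely many sections [x j] and [e > 0], each [x j] of norm at least
    [e] almost attains its norm at some point; collect these points, without
    repetition, in a finite family [s]. The fiber over [s k] supplies a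
    representation [pi k] on a Hilbert space and a finite-rank projection [P k]
    that almost commutes with the values [x j (s k)] and almost preserves their
    norms. The direct sum of the representations [sigma k := pi k \o evaluation
    at s k], with the direct sum of the [P k], is the required model of the
    algebra of sections: operator norms of diagonal operators are maxima over
    the blocks, so both estimates pass to the sum. What has to be proved is that
    the sum of the projections still lies in the bicommutant.

    Let [T] commute with the summed representation, with matrix entries [T i j].
    Two facts make the off-diagonal entries harmless.

    - The values of a section at distinct points are independent
      ([c0_section_prescribed]): a cutoff function separates the points, and
      every element of a fiber is exactly the value of a section, by successive
      approximation in the complete algebra of sections. Exactness matters:
      a merely dense set of values would call for the norm continuity of the
      representations. Hence [T i i] commutes with [pi i], while for [i != j]
      the range of [T i j] is annihilated by [pi i], and [T i j] annihilates
      the range of [pi j].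

    - Representations may be degenerate, and then [T i j] can be any operator
      between the null spaces, on which the projections [P k] act as unrelated
      scalars 0 or 1. So each [P k] is first cut down to the orthogonal
      complement of the null space ([essential_cutdown]). This changes neither
      [P k \o pi k a] nor [pi k a \o P k], and the new projection is still in
      the bicommutant, because the projection onto the null space commutes with
      the commutant. Afterwards [P i \o T i j = 0 = T i j \o P j] for [i != j],
      and [bicommutant_diag] follows.

    The cut-down relies on the projection theorem for closed subspaces of a
    Hilbert space ([orthogonal_decomposition]), also used to show that a bounded
    operator killing all vectors [pi a h] kills the complement of the null space
    ([vanish_orthogonal_null_space]). *)

(** * Real parts of inner products *)

Section dot.
Context {R : realType} {H : hilbertType R}.
Implicit Types (x y z : H) (l : R[i]) (r : R).

Lemma innerDl x y z : inner (x + y) z = inner x z + inner y z.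
Proof. by rewrite -[x]scale1r inner_linearl mul1r scale1r. Qed.

Lemma inner0l z : inner 0 z = 0.
Proof. by apply: (addrI (inner 0 z)); rewrite -innerDl !addr0. Qed.

Lemma innerZl l x z : inner (l *: x) z = l * inner x z.
Proof. by rewrite -[l *: x]addr0 inner_linearl inner0l addr0. Qed.

Lemma innerNl x z : inner (- x) z = - inner x z.
Proof. by rewrite -scaleN1r innerZl mulN1r. Qed.

Lemma innerBl x y z : inner (x - y) z = inner x z - inner y z.
Proof. by rewrite innerDl innerNl. Qed.

Lemma inner0r z : inner z 0 = 0.
Proof. by rewrite inner_conj inner0l rmorph0. Qed.

Lemma innerZr l x y : inner x (l *: y) = l^* * inner x y.
Proof. by rewrite inner_conj innerZl rmorphM/= -inner_conj. Qed.

Lemma innerBr x y z : inner x (y - z) = inner x y - inner x z.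
Proof. by rewrite inner_conj innerBl rmorphB/= -!inner_conj. Qed.

Lemma inner_self_eq0 x : inner x x = 0 -> x = 0.
Proof.
by rewrite inner_norm => /eqP; rewrite sqrf_eq0 normr_eq0 => /eqP.
Qed.

(** A complex Hilbert space is used below as a real one: lengths, distances and
    orthogonality to a complex subspace only see the real part. *)
Definition dot x y : R := complex.Re (inner x y).

Lemma dotC x y : dot x y = dot y x.
Proof.
rewrite /dot inner_conj /Num.conj; case: (inner y x) => a b //=.
Qed.

Lemma dotDl x y z : dot (x + y) z = dot x z + dot y z.
Proof. by rewrite /dot innerDl; case: inner; case: inner. Qed.

Lemma dotZl r x z : dot (r%:C%C *: x) z = r * dot x z.
Proof. by rewrite /dot innerZl; case: inner => a b /=; ring. Qed.

Lemma dotNl x z : dot (- x) z = - dot x z.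
Proof. by rewrite /dot innerNl; case: inner. Qed.

Lemma dotDr x y z : dot z (x + y) = dot z x + dot z y.
Proof. by rewrite dotC dotDl !(dotC z). Qed.

Lemma dotZr r x z : dot z (r%:C%C *: x) = r * dot z x.
Proof. by rewrite dotC dotZl (dotC z). Qed.

Lemma dotNr x z : dot z (- x) = - dot z x.
Proof. by rewrite dotC dotNl (dotC z). Qed.

Lemma dotxx x : dot x x = rnorm x ^+ 2.
Proof. by rewrite /dot inner_norm rnormE -rmorphXn. Qed.

Lemma rnormD_sqr x y :
  rnorm (x + y) ^+ 2 = rnorm x ^+ 2 + 2 * dot x y + rnorm y ^+ 2.
Proof. by rewrite -!dotxx dotDl !dotDr (dotC y x); ring. Qed.

Lemma rnormB_sqr x y :
  rnorm (x - y) ^+ 2 = rnorm x ^+ 2 - 2 * dot x y + rnorm y ^+ 2.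
Proof. by rewrite rnormD_sqr rnormN dotNr; ring. Qed.

Lemma parallelogram x y :
  rnorm (x - y) ^+ 2 = 2 * rnorm x ^+ 2 + 2 * rnorm y ^+ 2 - rnorm (x + y) ^+ 2.
Proof. by rewrite rnormB_sqr rnormD_sqr; ring. Qed.

End dot.

(** * Completeness and boundedness in terms of real norms *)

Section sequences.
Context {R : realType}.

Lemma rnorm_realZ (V : normedModType R[i]) (r : R) (x : V) :
  rnorm (r%:C%C *: x) = `|r| * rnorm x.
Proof. by rewrite rnormZ normc_def /= expr0n addr0 sqrtr_sqr. Qed.

Lemma complex_gt0P (e : R[i]) : 0 < e -> exists2 r : R, 0 < r & e = r%:C%C.
Proof.
move=> e0; have /complex_realP[r re] : e \is Num.real by rewrite gtr0_real.
by exists r => //; rewrite -ltcR -re.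
Qed.

Lemma ex_invSn_lt (e : R) : 0 < e -> exists N : nat, N.+1%:R^-1 < e.
Proof.
move=> e0; have [N _ HN] := @near_infty_natSinv_lt R (PosNum e0).
by exists N; exact: (HN N (leqnn N)).
Qed.

Definition tends_to (V : normedModType R[i]) (u : nat -> V) (l : V) :=
  forall e : R, 0 < e -> exists N, forall n, (N <= n)%N -> rnorm (u n - l) < e.

Lemma cauchy_sequence_tends_to (V : completeNormedModType R[i]) (u : nat -> V) :
  (forall e : R, 0 < e -> exists N, forall n, (N <= n)%N ->
     rnorm (u n - u N) < e) ->
  exists l, tends_to u l.
Proof.
move=> cu.
have : cvg (u @ \oo).
  apply: cauchy_cvg; apply: cauchy_exP => _ /complex_gt0P[e e0 ->].
  have [N uN] := cu _ e0; exists (u N); exists N => // n /= /uN.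
  by rewrite -ball_normE/= -ltcR -rnormE distrC.
move=> /cvg_ex[l ul]; exists l => e e0.
have /cvgrPdist_lt/(_ e%:C%C) := ul; rewrite ltcR => /(_ e0)[N _ uN].
by exists N => n /uN/=; rewrite rnormE ltcR rdistC.
Qed.

Lemma ex_geometric_lt (c e : R) : 0 <= c -> 0 < e ->
  exists N : nat, c * 2^-1 ^+ N < e.
Proof.
move=> c0 e0; have c1 : 0 < c + 1 by rewrite ltr_wpDl.
have [N HN] := ex_invSn_lt (divr_gt0 e0 c1); exists N.
have pN : 2^-1 ^+ N <= N.+1%:R^-1 :> R.
  by rewrite exprVn lef_pV2 ?posrE ?exprn_gt0// -natrX ler_nat ltn_expl.
apply: le_lt_trans (_ : (c + 1) * 2^-1 ^+ N < e).
  by rewrite ler_wpM2r ?exprn_ge0 ?invr_ge0// lerDl.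
by rewrite mulrC -ltr_pdivlMr// (le_lt_trans pN HN).
Qed.

Lemma geometric_tends_to (V : completeNormedModType R[i]) (u : nat -> V)
    (c : R) :
  0 <= c -> (forall n, rnorm (u n.+1 - u n) <= c * 2^-1 ^+ n) ->
  exists l, tends_to u l.
Proof.
move=> c0 uc; apply: cauchy_sequence_tends_to => e e0.
have tail N k : rnorm (u (N + k)%N - u N) <=
    2 * c * (2^-1 ^+ N - 2^-1 ^+ (N + k)).
  elim: k => [|k IH]; first by rewrite addn0 !subrr rnorm0 mulr0.
  rewrite addnS -(subrKA (u (N + k)%N)) (le_trans (rnormD _ _))//.
  apply: le_trans (lerD (uc _) IH) _; rewrite exprS.
  by set h := _ ^+ (N + k); lra.
have [|N HN] := @ex_geometric_lt (2 * c) e _ e0; first by rewrite mulr_ge0.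
exists N => n Nn; rewrite -(subnKC Nn).
apply: le_lt_trans (tail _ _) (le_lt_trans _ HN).
by rewrite ler_wpM2l ?mulr_ge0// gerBl exprn_ge0 ?invr_ge0.
Qed.

End sequences.

Section linear_maps.
Context {R : realType} {V W : lmodType R[i]}.

Lemma linear_0 (T : V -> W) : linear T -> T 0 = 0.
Proof.
by move=> l; have := l (-1) 0 0; rewrite scaler0 addr0 scaleN1r addNr.
Qed.

Lemma linear_D (T : V -> W) : linear T -> forall x y, T (x + y) = T x + T y.
Proof. by move=> l x y; have := l 1 x y; rewrite !scale1r. Qed.

Lemma linear_Z (T : V -> W) : linear T -> forall a x, T (a *: x) = a *: T x.
Proof. by move=> l a x; have := l a x 0; rewrite (linear_0 l) !addr0. Qed.

Lemma linear_B (T : V -> W) : linear T -> forall x y, T (x - y) = T x - T y.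
Proof.
by move=> l x y; rewrite (linear_D l) -scaleN1r (linear_Z l) scaleN1r.
Qed.

Lemma linear_sum (T : V -> W) (I : Type) (s : seq I) (F : I -> V) : linear T ->
  T (\sum_(k <- s) F k) = \sum_(k <- s) T (F k).
Proof. by move=> l; apply: (big_morph T (linear_D l) (linear_0 l)). Qed.

End linear_maps.

Section bounded.
Context {R : realType} {V W : normedModType R[i]}.

Definition bounded_by (T : V -> W) (c : R) : Prop :=
  0 <= c /\ forall x, rnorm (T x) <= c * rnorm x.

Lemma linear_continuousP (T : V -> W) : linear T ->
  continuous T <-> exists c, bounded_by T c.
Proof.
move=> linT.
pose Tl : {linear V -> W} := HB.pack T (GRing.isLinear.Build _ _ _ _ T linT).
rewrite -[continuous T]/(continuous Tl) -linear_bounded_continuous.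
rewrite linear_boundedP; split.
  move=> /pinfty_ex_gt0[r r0 Tr].
  have /complex_realP[c rc] : r \is Num.real by rewrite gtr0_real.
  exists c; split=> [|x]; first by rewrite -lecR -rc ltW.
  by rewrite -lecR rmorphM/= -!rnormE -rc; exact: Tr.
move=> [c [c0 Tc]]; exists c%:C%C; split.
  by apply/complex_realP; exists c.
move=> r /ltW cr x; apply: le_trans (_ : c%:C%C * `|x| <= _).
  by rewrite !rnormE -rmorphM lecR; exact: Tc.
by rewrite ler_wpM2r.
Qed.

End bounded.

(** * Orthogonal projections *)

Section projection_theorem.
Context {R : realType} {H : hilbertType R}.
Implicit Types (x y z u v w : H) (K : set H).

Definition closed_subspace K : Prop :=
  [/\ K 0,
      forall (l : R[i]) x y, K x -> K y -> K (l *: x + y) &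
      forall x, (forall e : R, 0 < e -> exists2 u, K u & rnorm (x - u) < e) ->
        K x].

Lemma closed_subspaceZ K l x : closed_subspace K -> K x -> K (l *: x).
Proof. by move=> [K0 KD _] Kx; rewrite -[_ *: _]addr0; exact: KD. Qed.

Lemma closed_subspaceD K x y : closed_subspace K -> K x -> K y -> K (x + y).
Proof. by move=> [_ KD _] Kx Ky; rewrite -[x]scale1r; exact: KD. Qed.

Lemma closed_subspaceB K x y : closed_subspace K -> K x -> K y -> K (x - y).
Proof.
by move=> Kc Kx Ky; rewrite -scaleN1r; apply: closed_subspaceD => //;
  exact: closed_subspaceZ.
Qed.

(** A nearest point of a subspace is the foot of a perpendicular: moving the
    foot by a small real multiple of [w] changes the squared distance, to first
    order, by the real part of the inner product with [w]; replacing [w] by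
    ['i w] reaches the imaginary part. *)
Lemma nearest_point_orthogonal K x u : closed_subspace K -> K u ->
  (forall v, K v -> rnorm (x - u) <= rnorm (x - v)) ->
  forall w, K w -> inner (x - u) w = 0.
Proof.
move=> Kc Ku near.
have dot0 w : K w -> dot (x - u) w = 0.
  move=> Kw; set b := dot (x - u) w; set c := rnorm w ^+ 2.
  have c0 : 0 <= c by rewrite sqr_ge0.
  (* The minimum of the quadratic is at [b / c]; [c + 1] avoids [c = 0]. *)
  pose t := b / (c + 1).
  have := near (u + t%:C%C *: w).
  rewrite opprD addrA.
  move=> /(_ (closed_subspaceD Kc Ku (closed_subspaceZ _ Kc Kw))).
  rewrite -ler_sqr ?nnegrE ?rnorm_ge0// (rnormB_sqr (x - u)) dotZr -/b.
  rewrite rnorm_realZ exprMn real_normK ?num_real// -/c => h.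
  have c1 : c + 1 != 0 by rewrite gt_eqF// ltr_wpDl.
  have bE : b = t * (c + 1) by rewrite /t divfK.
  have : t ^+ 2 <= 0.
    have : 0 <= - (t ^+ 2 * (c + 2)).
      by rewrite bE in h; move: h; set s := rnorm _ ^+ 2; lra.
    rewrite oppr_ge0 pmulr_lle0//; lra.
  move=> t0; have /eqP : t ^+ 2 = 0 by apply/le_anti; rewrite t0 sqr_ge0.
  by rewrite bE sqrf_eq0 => /eqP->; rewrite mul0r.
move=> w Kw; have Kiw := closed_subspaceZ 'i%C Kc Kw.
have := dot0 _ Kw; have := dot0 _ Kiw; rewrite /dot innerZr /Num.conj.
case: (inner _ _) => a b /= h1 h2; apply/eqP; rewrite eq_complex /=.
by apply/andP; split; apply/eqP; lra.
Qed.

(** Points of [K] almost as close to [x] as possible form a Cauchy sequence, by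
    the parallelogram law, and its limit is a nearest point. *)
Lemma orthogonal_decomposition K x : closed_subspace K ->
  exists2 u, K u & forall w, K w -> inner (x - u) w = 0.
Proof.
move=> Kc; have [K0 KD Kcl] := Kc.
pose D := [set rnorm (x - u) | u in K].
have Dlb : has_lbound D by exists 0 => _ [u _ <-]; exact: rnorm_ge0.
have Dinf : has_inf D by split => //; exists (rnorm (x - 0)), 0.
pose d := inf D.
have dle u : K u -> d <= rnorm (x - u).
  by move=> Ku; apply: ge_inf => //; exists u.
have d0 : 0 <= d.
  by apply: lb_le_inf => [|_ [u _ <-]]; [case: Dinf|exact: rnorm_ge0].
have near_inf n : exists u, K u /\ rnorm (x - u) < d + n.+1%:R^-1.
  have /(inf_adherent)/(_ Dinf)[_ [u Ku <-] ud] : 0 < n.+1%:R^-1 :> R by [].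
  by exists u.
have [u uP] := choice near_inf.
have near_le N n : (N <= n)%N -> rnorm (x - u n) <= d + N.+1%:R^-1.
  move=> Nn; apply: le_trans (ltW (uP n).2) _.
  by rewrite lerD2l lef_pV2 ?posrE// ler_nat ltnS.
have [l ul] : exists l, tends_to u l.
  apply: cauchy_sequence_tends_to => e e0.
  have p0 : 0 < e ^+ 2 / (4 * (2 * d + 1)).
    by rewrite divr_gt0 ?exprn_gt0// mulr_gt0// ltr_wpDl ?mulr_ge0.
  have [N] := ex_invSn_lt p0.
  rewrite ltr_pdivlMr; last by rewrite mulr_gt0// ltr_wpDl ?mulr_ge0.
  move=> HN; exists N => n Nn.
  (* Two almost nearest points are close, since their midpoint lies in [K]. *)
  have mid : 2 * d <= rnorm ((x - u n) + (x - u N)).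
    have Km : K ((2^-1 : R)%:C%C *: (u n + u N)).
      apply: (closed_subspaceZ _ Kc); apply: (closed_subspaceD Kc);
        exact: (uP _).1.
    have := dle _ Km.
    have -> : x - (2^-1 : R)%:C%C *: (u n + u N) =
        (2^-1 : R)%:C%C *: ((x - u n) + (x - u N)).
      rewrite addrACA -opprD scalerBr; congr (_ - _).
      rewrite scalerDr -scalerDl -rmorphD/=.
      by rewrite (_ : 2^-1 + 2^-1 = 1 :> R) ?scale1r//; lra.
    by rewrite rnorm_realZ ger0_norm ?invr_ge0//; lra.
  rewrite -ltr_sqr ?nnegrE ?rnorm_ge0 ?(ltW e0)//.
  rewrite (_ : u n - u N = (x - u N) - (x - u n)); last first.
    by rewrite opprB [RHS]addrC addrA subrK.
  rewrite parallelogram [X in _ - rnorm X ^+ 2]addrC.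
  apply: le_lt_trans HN; set a := N.+1%:R^-1.
  have a01 : 0 < a <= 1.
    by rewrite invr_gt0 ltr0n/= invf_le1 ?ltr0n// ler1n.
  have near_sqr k : (N <= k)%N -> rnorm (x - u k) ^+ 2 <= (d + a) ^+ 2.
    move=> /near_le xk; rewrite ler_sqr ?nnegrE ?rnorm_ge0//.
    exact: le_trans (rnorm_ge0 _) xk.
  have h1 := near_sqr _ Nn; have h2 := near_sqr _ (leqnn N).
  have h3 : (2 * d) ^+ 2 <= rnorm (x - u n + (x - u N)) ^+ 2.
    by rewrite ler_sqr ?nnegrE ?rnorm_ge0 ?mulr_ge0.
  move: h1 h2 h3; set A := rnorm _ ^+ 2; set B := rnorm _ ^+ 2.
  set C := rnorm _ ^+ 2 => h1 h2 h3; nra.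
have Kl : K l.
  apply: Kcl => e /ul[N uN]; exists (u N); first exact: (uP N).1.
  by rewrite rdistC uN.
exists l => //; apply: nearest_point_orthogonal => // v Kv.
suff le_d (e : R) : 0 < e -> rnorm (x - l) <= d + e.
  by apply: le_trans (dle _ Kv); apply/ler_addgt0Pr => e; exact: le_d.
move=> e0; have e20 : 0 < e / 2 by rewrite divr_gt0.
have [N ulN] := ul _ e20; have [M HM] := ex_invSn_lt e20.
rewrite -(subrKA (u (maxn N M))) (le_trans (rnormD _ _))//.
have h1 := near_le M (maxn N M) (leq_maxr _ _).
have h2 := ulN (maxn N M) (leq_maxl _ _).
rewrite (le_trans (lerD h1 (ltW h2)))// -addrA lerD2l [leRHS]splitr.
by rewrite lerD2r ltW.
Qed.

Definition orthogonal_projection K (Q : H -> H) : Prop :=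
  forall x, K (Q x) /\ forall w, K w -> inner (x - Q x) w = 0.

Lemma ex_orthogonal_projection K : closed_subspace K ->
  exists Q, orthogonal_projection K Q.
Proof.
move=> Kc; have ex x : exists u, K u /\ forall w, K w -> inner (x - u) w = 0.
  by have [u] := orthogonal_decomposition x Kc; exists u.
by have [Q] := choice ex; exists Q.
Qed.

Section properties.
Context (K : set H) (Kc : closed_subspace K) (Q : H -> H).
Hypothesis QK : orthogonal_projection K Q.

Lemma orthogonal_projection_unique x u : K u ->
  (forall w, K w -> inner (x - u) w = 0) -> Q x = u.
Proof.
move=> Ku xu; have [KQ xQ] := QK x.
have Kd : K (Q x - u) by exact: closed_subspaceB.
apply/eqP; rewrite -subr_eq0; apply/eqP/inner_self_eq0.
rewrite [X in inner X _](_ : _ = (x - u) - (x - Q x)).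
  by rewrite innerBl xu// xQ// subrr.
by rewrite opprB [RHS]addrC addrA subrK.
Qed.

Lemma orthogonal_projection_id x : K x -> Q x = x.
Proof.
move=> Kx; apply: orthogonal_projection_unique => // w _.
by rewrite subrr inner0l.
Qed.

Lemma orthogonal_projection_eq0 x : (forall w, K w -> inner x w = 0) -> Q x = 0.
Proof.
move=> xK; apply: orthogonal_projection_unique => [|w Kw]; first by case: Kc.
by rewrite subr0 xK.
Qed.

Lemma orthogonal_projection_linear : linear Q.
Proof.
move=> l x y; have [[Kx Ox] [Ky Oy]] := (QK x, QK y).
apply: orthogonal_projection_unique => [|w Kw].
  by case: Kc => _ + _; apply.
rewrite opprD addrACA -scalerBr innerDl innerZl Ox// Oy// mulr0 addr0//.
Qed.

Lemma orthogonal_projection_contraction : bounded_by Q 1.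
Proof.
split=> // x; rewrite mul1r -ler_sqr ?nnegrE ?rnorm_ge0//.
have [KQ OQ] := QK x.
rewrite -[in leRHS](subrK (Q x) x) rnormD_sqr /dot OQ//= mulr0 addr0 lerDr.
exact: sqr_ge0.
Qed.

Lemma orthogonal_projection_selfadjoint x y : inner (Q x) y = inner x (Q y).
Proof.
have [[Kx Ox] [Ky Oy]] := (QK x, QK y).
rewrite -[in LHS](subrK (Q y) y) -[in RHS](subrK (Q x) x).
rewrite [RHS]innerDl Ox// add0r.
by rewrite [LHS]inner_conj innerDl Oy// add0r -inner_conj.
Qed.

End properties.

End projection_theorem.

(** * Bounded operators and operator norms *)

Section operator_norm.
Context {R : realType} {H : hilbertType R}.
Implicit Types T U : H -> H.

Lemma bounded_operatorP T :
  bounded_operator T <-> linear T /\ exists c, bounded_by T c.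
Proof. by split=> -[linT] /(linear_continuousP linT). Qed.

Lemma bounded_operator_comp T U :
  bounded_operator T -> bounded_operator U -> bounded_operator (T \o U).
Proof.
move=> [lT cT] [lU cU]; split=> [l x y|x] /=; first by rewrite lU lT.
by apply: continuous_comp; [exact: cU|exact: cT].
Qed.

Lemma bounded_operator_sub T U :
  bounded_operator T -> bounded_operator U -> bounded_operator (T \- U).
Proof.
move=> [lT cT] [lU cU]; split=> [l x y|x] /=.
  by rewrite lU lT scalerBr opprD addrACA.
by apply: cvgB; [exact: cT|exact: cU].
Qed.

Lemma opnorm_le T c : bounded_by T c -> opnorm T <= c.
Proof.
move=> [c0 Tc]; rewrite /opnorm; set D := (X in sup X).
have [->|/set0P ne] := eqVneq D set0; first by rewrite sup0.
apply: ge_sup => // _ [x /= x1 <-].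
by rewrite (le_trans (Tc x))// -[leRHS]mulr1 ler_wpM2l.
Qed.

Lemma opnorm_ge_unit T x : bounded_operator T -> rnorm x <= 1 ->
  rnorm (T x) <= opnorm T.
Proof.
move=> /bounded_operatorP[_ [c [c0 Tc]]] x1; apply: ub_le_sup; last by exists x.
exists c => _ [y /= y1 <-].
by rewrite (le_trans (Tc y))// -[leRHS]mulr1 ler_wpM2l.
Qed.

Lemma opnorm_ge0 T : bounded_operator T -> 0 <= opnorm T.
Proof.
move=> bT; apply: le_trans (rnorm_ge0 (T 0)) _.
by apply: opnorm_ge_unit => //; rewrite rnorm0.
Qed.

Lemma opnormP T : bounded_operator T -> bounded_by T (opnorm T).
Proof.
move=> bT; split=> [|x]; first exact: opnorm_ge0.
have [x0|x0] := eqVneq (rnorm x) 0.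
  by rewrite (rnorm0_eq0 x0) (linear_0 bT.1) rnorm0 mulr0.
have px : 0 < rnorm x by rewrite lt_neqAle eq_sym x0 rnorm_ge0.
have := @opnorm_ge_unit T ((rnorm x)^-1%:C%C *: x) bT.
rewrite (linear_Z bT.1) !rnorm_realZ ger0_norm ?invr_ge0 ?rnorm_ge0//.
by rewrite mulVf// => /(_ (lexx _)); rewrite mulrC ler_pdivrMr.
Qed.

Lemma comp_eqP T U : T \o U = U \o T <-> forall x, T (U x) = U (T x).
Proof. by split=> [e x|e]; [exact: (congr1 (@^~ x) e)|apply/funext]. Qed.

End operator_norm.

(** * Discarding the degenerate part of a representation *)

Section closed_kernels.
Context {R : realType} {H : hilbertType R} {W : normedModType R[i]}.

Lemma closed_subspace_kernel (T : H -> W) (c : R) :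
  linear T -> bounded_by T c -> closed_subspace [set x | T x = 0].
Proof.
move=> linT [c0 Tc]; split=> /=; first exact: linear_0.
  by move=> l x y Tx Ty; rewrite linT Tx Ty scaler0 addr0.
move=> x xK; apply/rnorm0_eq0/eqP; rewrite eq_le rnorm_ge0 andbT.
suff le_e (e : R) : 0 < e -> rnorm (T x) <= 0 + e by apply/ler_addgt0Pr.
move=> e0; have c1 : 0 < c + 1 by rewrite ltr_wpDl.
have [u /= Tu xu] := xK _ (divr_gt0 e0 c1).
rewrite add0r -[T x]subr0 -Tu -(linear_B linT) (le_trans (Tc _))//.
apply: le_trans (_ : (c + 1) * rnorm (x - u) <= _).
  by rewrite ler_wpM2r ?rnorm_ge0// lerDl.
by rewrite mulrC -ler_pdivlMr// ltW.
Qed.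

Lemma closed_subspace_bigcap (I : Type) (K : I -> set H) :
  (forall i, closed_subspace (K i)) ->
  closed_subspace [set x | forall i, K i x].
Proof.
move=> Kc; split=> /= [i|l x y Kx Ky i|x xK i]; first by case: (Kc i).
  by case: (Kc i) => _ + _; apply.
case: (Kc i) => _ _; apply=> e /xK[u Ku xu]; exists u => //; exact: Ku.
Qed.

End closed_kernels.

Section essential_part.
Context {R : realType} {A : cstarType R} {H : hilbertType R}.
Variable pi : A -> H -> H.
Hypothesis pi_rep : representation pi.

Definition null_space : set H := [set u | forall a, pi a u = 0].

Let pi_bounded a : bounded_operator (pi a).
Proof. by case: pi_rep. Qed.

Lemma closed_null_space : closed_subspace null_space.
Proof.
apply: closed_subspace_bigcap => a.
have [linT [c bT]] := (bounded_operatorP _).1 (pi_bounded a).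
exact: closed_subspace_kernel linT bT.
Qed.

(** The vectors [pi a h] span a dense subspace of the orthogonal complement of
    the null space: a vector orthogonal to all of them is annihilated by every
    adjoint [pi (cstar a)]. *)
Lemma vanish_orthogonal_null_space (W : normedModType R[i]) (T : H -> W)
    (c : R) :
  linear T -> bounded_by T c -> (forall a h, T (pi a h) = 0) ->
  forall y, (forall u, null_space u -> inner y u = 0) -> T y = 0.
Proof.
move=> linT bT Tpi y yN; have Kc := closed_subspace_kernel linT bT.
have [u /= Tu yu] := orthogonal_decomposition y Kc.
have [_ _ _ pi_star] := pi_rep.
have zN : null_space (y - u).
  move=> a; apply: inner_self_eq0; rewrite -[a]cstarK -pi_star cstarK.
  by rewrite inner_conj yu ?rmorph0//= Tpi.
have /inner_self_eq0/eqP : inner (y - u) (y - u) = 0.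
  by rewrite innerBl yN// sub0r inner_conj yu// rmorph0 oppr0.
by rewrite subr_eq0 => /eqP->.
Qed.

(** [T] maps the null space into itself, and it also preserves the complement:
    [Q \o T] vanishes on every [pi a h], hence on that complement. *)
Lemma null_space_projection_commutes (Q T : H -> H) :
  orthogonal_projection null_space Q -> commutant (range pi) T ->
  forall x, Q (T x) = T (Q x).
Proof.
move=> QN [bT Tpi]; have Nc := closed_null_space.
have {}Tpi a x : T (pi a x) = pi a (T x).
  by apply: (comp_eqP T (pi a)).1; apply: Tpi; exists a.
have [_ _ _ pi_star] := pi_rep.
have Qpi a x : Q (pi a x) = 0.
  apply: (orthogonal_projection_eq0 Nc QN) => w Nw.
  by rewrite pi_star Nw inner0r.
have linT := bT.1; have linQ := orthogonal_projection_linear Nc QN.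
have [_ [c bTc]] := (bounded_operatorP _).1 bT.
have QT0 y : (forall u, null_space u -> inner y u = 0) -> Q (T y) = 0.
  apply: (vanish_orthogonal_null_space (c := c) (T := Q \o T)).
  - by move=> l u v /=; rewrite linT linQ.
  - split=> [|u /=]; first by case: bTc.
    have [_ /(_ (T u))] := orthogonal_projection_contraction QN.
    by rewrite mul1r => /le_trans; apply; case: bTc.
  - by move=> a h /=; rewrite Tpi Qpi.
move=> x; rewrite -[in LHS](subrK (Q x) x) (linear_D linT) (linear_D linQ).
rewrite QT0 ?add0r; last by have [] := QN x.
apply: (orthogonal_projection_id Nc QN) => a.
by rewrite -Tpi (QN x).1 (linear_0 linT).
Qed.

(** Any projection of the bicommutant acts as a scalar on the null space, where
    the representation carries no information; cutting it down to the
    complement changes none of the operators that measure quasidiagonality. *)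
Lemma essential_cutdown (P : H -> H) :
  projection P -> finite_rank P -> bicommutant (range pi) P ->
  exists P' : H -> H,
    [/\ projection P', finite_rank P', bicommutant (range pi) P',
        forall u, null_space u -> P' u = 0 &
        forall a, P' \o pi a = P \o pi a /\ pi a \o P' = pi a \o P].
Proof.
move=> [bP PP Padj] [n [e Pe]] [_ Pcomm].
have Nc := closed_null_space.
have [Q QN] := ex_orthogonal_projection Nc.
have linQ := orthogonal_projection_linear Nc QN.
have bQ : bounded_operator Q.
  apply/bounded_operatorP; split=> //; exists 1.
  exact: (orthogonal_projection_contraction QN).
have [_ _ _ pi_star] := pi_rep.
have Qpi a x : Q (pi a x) = 0.
  apply: (orthogonal_projection_eq0 Nc QN) => w Nw.
  by rewrite pi_star Nw inner0r.
have piQ a x : pi a (Q x) = 0 by apply: (QN x).1.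
have commQ : commutant (range pi) Q.
  by split=> // _ [a _ <-]; apply/comp_eqP => x; rewrite Qpi piQ.
have PQ x : P (Q x) = Q (P x) by apply: (comp_eqP P Q).1; exact: Pcomm.
have QQ x : Q (Q x) = Q x.
  by apply: (orthogonal_projection_id Nc QN); case: (QN x).
have linP := bP.1.
have PPx x : P (P x) = P x by exact: (congr1 (@^~ x) PP).
have bP' : bounded_operator (P \o (idfun \- Q)).
  apply: bounded_operator_comp => //; apply: bounded_operator_sub => //.
  by split=> // x; exact: cvg_id.
exists (P \o (idfun \- Q)); split.
- split=> //.
    apply/funext => x /=; rewrite -PQ (linear_B linQ) QQ subrr (linear_0 linP).
    by rewrite subr0 PPx.
  move=> x y /=; rewrite Padj innerBl (orthogonal_projection_selfadjoint QN).
  by rewrite -PQ -innerBr -(linear_B linP).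
- by exists n, e => x; exact: Pe.
- split=> // T TA; apply/comp_eqP => x /=.
  rewrite (null_space_projection_commutes QN TA).
  have linT : linear T by case: TA => -[].
  by rewrite -(linear_B linT); apply: (comp_eqP P T).1; exact: Pcomm.
- move=> u Nu /=; rewrite (orthogonal_projection_id Nc QN Nu) subrr.
  exact: linear_0.
- move=> a; split; apply/funext => x /=; first by rewrite Qpi subr0.
  by rewrite (linear_B linP) PQ (linear_B (pi_bounded a).1) piQ subr0.
Qed.

End essential_part.

(** * Direct sums of Hilbert spaces *)

Section hilbert_sum.
Context {R : realType} {n : nat} (H : 'I_n -> hilbertType R).

(** The alias keeps the Euclidean structures below apart from the product ones
    that dependent functions may carry. *)
Definition hsum : Type := forall i, H i.

HB.instance Definition _ := gen_eqMixin hsum.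
HB.instance Definition _ := gen_choiceMixin hsum.

Implicit Types (x y z : hsum) (l : R[i]).

Lemma hsumP x y : (forall i, x i = y i) -> x = y.
Proof. exact: functional_extensionality_dep. Qed.

Definition hsum_zero : hsum := fun=> 0.
Definition hsum_add x y : hsum := fun i => x i + y i.
Definition hsum_opp x : hsum := fun i => - x i.
Definition hsum_scale l x : hsum := fun i => l *: x i.

Let hsum_addA : associative hsum_add.
Proof. by move=> x y z; apply: hsumP => i; exact: addrA. Qed.

Let hsum_addC : commutative hsum_add.
Proof. by move=> x y; apply: hsumP => i; exact: addrC. Qed.

Let hsum_add0 : left_id hsum_zero hsum_add.
Proof. by move=> x; apply: hsumP => i; exact: add0r. Qed.

Let hsum_addN : left_inverse hsum_zero hsum_opp hsum_add.
Proof. by move=> x; apply: hsumP => i; exact: addNr. Qed.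

HB.instance Definition _ :=
  GRing.isZmodule.Build hsum hsum_addA hsum_addC hsum_add0 hsum_addN.

Let hsum_scaleA l m x : hsum_scale l (hsum_scale m x) = hsum_scale (l * m) x.
Proof. by apply: hsumP => i; exact: scalerA. Qed.

Let hsum_scale1 : left_id 1 hsum_scale.
Proof. by move=> x; apply: hsumP => i; exact: scale1r. Qed.

Let hsum_scaleDr : right_distributive hsum_scale +%R.
Proof. by move=> l x y; apply: hsumP => i; exact: scalerDr. Qed.

Let hsum_scaleDl x : {morph hsum_scale^~ x : l m / l + m}.
Proof. by move=> l m; apply: hsumP => i; exact: scalerDl. Qed.

HB.instance Definition _ := GRing.Zmodule_isLmodule.Build R[i] hsum
  hsum_scaleA hsum_scale1 hsum_scaleDr hsum_scaleDl.

Lemma hsumDE x y i : (x + y) i = x i + y i. Proof. by []. Qed.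
Lemma hsumZE l x i : (l *: x) i = l *: x i. Proof. by []. Qed.

Definition sqnorm x : R := \sum_(i < n) rnorm (x i) ^+ 2.
Definition hsum_norm x : R := Num.sqrt (sqnorm x).

Lemma sqnorm_ge0 x : 0 <= sqnorm x.
Proof. by apply: sumr_ge0 => i _; exact: sqr_ge0. Qed.

Lemma hsum_norm_ge0 x : 0 <= hsum_norm x.
Proof. exact: sqrtr_ge0. Qed.

Lemma hsum_norm_sqr x : hsum_norm x ^+ 2 = sqnorm x.
Proof. by rewrite sqr_sqrtr// sqnorm_ge0. Qed.

Lemma hsum_norm_ge x i : rnorm (x i) <= hsum_norm x.
Proof.
rewrite -ler_sqr ?nnegrE ?rnorm_ge0 ?hsum_norm_ge0// hsum_norm_sqr.
rewrite /sqnorm (bigD1 i)//= lerDl.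
by apply: sumr_ge0 => j _; exact: sqr_ge0.
Qed.

Lemma hsum_norm_le_sum x : hsum_norm x <= \sum_(i < n) rnorm (x i).
Proof.
have s0 (s : seq 'I_n) : 0 <= \sum_(i <- s) rnorm (x i).
  by apply: sumr_ge0 => i _; exact: rnorm_ge0.
rewrite -ler_sqr ?nnegrE ?hsum_norm_ge0 ?s0// hsum_norm_sqr /sqnorm.
elim: (index_enum _) => [|i s IH]; first by rewrite !big_nil expr0n.
rewrite !big_cons sqrrD -addrA lerD2l (le_trans IH)// lerDr.
by rewrite mulrn_wge0// mulr_ge0 ?rnorm_ge0.
Qed.

Let sqnorm_comb (s t : R) x y :
  sqnorm (s%:C%C *: x - t%:C%C *: y) =
  s ^+ 2 * sqnorm x - 2 * s * t * (\sum_(i < n) dot (x i) (y i)) +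
  t ^+ 2 * sqnorm y.
Proof.
rewrite /sqnorm !mulr_sumr -sumrN -!big_split/=; apply: eq_bigr => i _.
rewrite rnormB_sqr dotZl dotZr !rnorm_realZ !exprMn.
rewrite !real_normK ?num_real//; ring.
Qed.

(** The discriminant argument of Cauchy and Schwarz: the vector
    [sqnorm y *: x - b *: y], with [b] the left-hand side, has nonnegative
    squared norm. *)
Let sum_dot_le x y : \sum_(i < n) dot (x i) (y i) <= hsum_norm x * hsum_norm y.
Proof.
set b := \sum_(i < n) _.
have [y0|y0] := eqVneq (sqnorm y) 0.
  have : hsum_norm y = 0 by rewrite /hsum_norm y0 sqrtr0.
  move=> ny0; rewrite ny0 mulr0 /b big1// => i _.
  have := hsum_norm_ge y i; rewrite ny0 => h.
  rewrite (@rnorm0_eq0 _ _ (y i)) /dot ?inner0r//.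
  by apply/le_anti; rewrite h rnorm_ge0.
have py : 0 < sqnorm y by rewrite lt_neqAle eq_sym y0 sqnorm_ge0.
rewrite (le_trans (ler_norm _))// -ler_sqr ?nnegrE ?mulr_ge0 ?hsum_norm_ge0//.
rewrite exprMn !hsum_norm_sqr real_normK ?num_real//.
have := sqnorm_ge0 ((sqnorm y)%:C%C *: x - b%:C%C *: y).
rewrite sqnorm_comb -/b (_ : _ + _ = sqnorm y * (sqnorm x * sqnorm y - b ^+ 2)).
  by rewrite pmulr_rge0// subr_ge0.
ring.
Qed.

Let hsum_normD x y :
  (hsum_norm (x + y))%:C%C <= (hsum_norm x)%:C%C + (hsum_norm y)%:C%C.
Proof.
rewrite -rmorphD/= lecR.
rewrite -ler_sqr ?nnegrE ?addr_ge0 ?hsum_norm_ge0//.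
have -> : x + y = (1 : R)%:C%C *: x - (-1 : R)%:C%C *: y.
  by rewrite scale1r rmorphN scaleN1r opprK.
rewrite hsum_norm_sqr sqnorm_comb sqrrD !hsum_norm_sqr.
have := sum_dot_le x y; set b := \sum_(i < n) _; rewrite -mulr_natl; lra.
Qed.

Let hsum_normZ l x : (hsum_norm (l *: x))%:C%C = `|l| * (hsum_norm x)%:C%C.
Proof.
have le : `|l| = (complex.Re `|l|)%:C%C by exact: (@rnormE _ (R[i]^o)).
rewrite le -rmorphM; congr (_%:C%C).
have l0 : 0 <= complex.Re `|l| by exact: (@rnorm_ge0 _ (R[i]^o)).
rewrite -[X in X * _](ger0_norm l0) -sqrtr_sqr -sqrtrM ?sqr_ge0//.
by congr Num.sqrt; rewrite /sqnorm mulr_sumr; apply: eq_bigr => i _;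
  rewrite rnormZ exprMn.
Qed.

Let hsum_norm_eq0 x : (hsum_norm x)%:C%C = 0 -> x = 0.
Proof.
move=> /complexI x0; apply: hsumP => i; apply: rnorm0_eq0.
by apply/eqP; rewrite eq_le rnorm_ge0 andbT -x0 hsum_norm_ge.
Qed.

HB.instance Definition _ := Lmodule_isNormed.Build R[i] hsum
  hsum_normD hsum_normZ hsum_norm_eq0.

Lemma hsum_rnormE x : rnorm x = hsum_norm x.
Proof. by []. Qed.

Let rnorm_ltP (V : normedModType R[i]) (v : V) (r : R) :
  (`|v| < r%:C%C) = (rnorm v < r).
Proof. by rewrite rnormE ltcR. Qed.

Let hsum_cauchy_cvg (G : set_system hsum) :
  ProperFilter G -> cauchy G -> cvg G.
Proof.
move=> FG cG.
pose u i : H i := lim ((fun x : hsum => x i) @ G).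
have Gu i (r : R) : 0 < r -> G [set x : hsum | rnorm (u i - x i) < r].
  move=> r0; have FGi : ProperFilter ((fun x : hsum => x i) @ G).
    exact: fmap_proper_filter.
  have : cvg ((fun x : hsum => x i) @ G).
    apply: cauchy_cvg; apply: cauchy_exP => _ /complex_gt0P[e e0 ->].
    have /cauchyP/(_ e%:C%C) := cG; rewrite ltcR => /(_ e0)[y Gy].
    exists (y i); change (G [set x : hsum | ball (y i) e%:C%C (x i)]).
    apply: filterS Gy => x /=; rewrite -!ball_normE/= !rnorm_ltP.
    exact: le_lt_trans (hsum_norm_ge (y - x) i).
  move=> /cvgrPdist_lt/(_ r%:C%C); rewrite ltcR => /(_ r0).
  by apply: (@filterS _ G) => x /=; rewrite rnorm_ltP.
apply/cvg_ex; exists (u : hsum).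
apply/cvgrPdist_le => _ /complex_gt0P[e e0 ->].
(* [n.+1] rather than [n], as the sum may be empty. *)
have d0 : 0 < e / n.+1%:R by rewrite divr_gt0.
have : G [set x : hsum | forall i, rnorm (u i - x i) < e / n.+1%:R].
  exact: (@filter_forall _ _
    (fun i (x : hsum) => rnorm (u i - x i) < e / n.+1%:R) G _
    (fun i => Gu i _ d0)).
apply: filterS => x /= ux; rewrite rnormE lecR hsum_rnormE.
apply: le_trans (hsum_norm_le_sum _) _.
apply: le_trans (_ : \sum_(i < n) e / n.+1%:R <= _).
  by apply: ler_sum => i _; exact: ltW.
rewrite sumr_const card_ord -[leLHS]mulr_natl mulrCA ger_pMr// ler_pdivrMr//.
by rewrite mul1r ler_nat.
Qed.

HB.instance Definition _ := Uniform_isComplete.Build hsum hsum_cauchy_cvg.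

Definition hsum_inner x y : R[i] := \sum_(i < n) inner (x i) (y i).

Let hsum_inner_linearl l x y z :
  hsum_inner (l *: x + y) z = l * hsum_inner x z + hsum_inner y z.
Proof.
rewrite /hsum_inner mulr_sumr -big_split/=; apply: eq_bigr => i _.
exact: inner_linearl.
Qed.

Let hsum_inner_conj x y : hsum_inner y x = (hsum_inner x y)^*.
Proof. by rewrite rmorph_sum; apply: eq_bigr => i _; exact: inner_conj. Qed.

Let hsum_inner_norm x : hsum_inner x x = `|x| ^+ 2.
Proof.
rewrite rnormE -rmorphXn/= hsum_rnormE hsum_norm_sqr rmorph_sum.
by apply: eq_bigr => i _; rewrite inner_norm rnormE rmorphXn.
Qed.

HB.instance Definition _ := CompleteNormedModule_isHilbert.Build R hsum
  hsum_inner_linearl hsum_inner_conj hsum_inner_norm.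

Definition hilbert_sum : hilbertType R := hsum.

Lemma hsum_innerE (x y : hilbert_sum) :
  inner x y = \sum_(i < n) inner (x i) (y i).
Proof. by []. Qed.

End hilbert_sum.

Section diagonal_operators.
Context {R : realType} {n : nat} {H : 'I_n -> hilbertType R}.
Local Notation D := (hilbert_sum H).

Definition hsum_inj (j : 'I_n) (h : H j) : D := dfwith (fun=> 0) j h.

Lemma hsum_inj_same j (h : H j) : hsum_inj h j = h.
Proof. exact: dfwithin. Qed.

Lemma hsum_inj_other i j (h : H j) : j != i -> hsum_inj h i = 0.
Proof. exact: dfwithout. Qed.

Lemma hsum_inj_linear j : linear (@hsum_inj j).
Proof.
move=> l x y; apply: hsumP => i; rewrite hsumDE hsumZE.
have [<-|ji] := eqVneq j i; first by rewrite !hsum_inj_same.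
by rewrite !hsum_inj_other// scaler0 addr0.
Qed.

Lemma rnorm_hsum_inj j (h : H j) : rnorm (hsum_inj h) = rnorm h.
Proof.
rewrite hsum_rnormE /hsum_norm /sqnorm (bigD1 j)//= hsum_inj_same big1.
  by rewrite addr0 sqrtr_sqr ger0_norm ?rnorm_ge0.
by move=> i ij; rewrite hsum_inj_other 1?eq_sym// rnorm0 expr0n.
Qed.

Lemma hsum_sumE (I : Type) (s : seq I) (F : I -> D) i :
  (\sum_(k <- s) F k) i = \sum_(k <- s) F k i.
Proof. by elim: s => [|k s IH]; rewrite ?big_nil// !big_cons -IH. Qed.

Lemma hsum_decomposition (x : D) : x = \sum_(j < n) hsum_inj (x j).
Proof.
apply: hsumP => i; rewrite hsum_sumE (bigD1 i)//= hsum_inj_same big1 ?addr0//.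
by move=> j ji; rewrite hsum_inj_other.
Qed.

Definition diag (T : forall i, H i -> H i) (x : D) : D := fun i => T i (x i).

Implicit Type T : forall i, H i -> H i.

Lemma diag_linear T : (forall i, linear (T i)) -> linear (diag T).
Proof. by move=> linT l x y; apply: hsumP => i; exact: linT. Qed.

Lemma diag_inj T j (h : H j) : (forall i, linear (T i)) ->
  diag T (hsum_inj h) = hsum_inj (T j h).
Proof.
move=> linT; apply: hsumP => i; rewrite /diag.
have [<-|ji] := eqVneq j i; first by rewrite !hsum_inj_same.
by rewrite !hsum_inj_other// (linear_0 (linT i)).
Qed.

Lemma bounded_by_diag T c : 0 <= c -> (forall i, bounded_by (T i) c) ->
  bounded_by (diag T) c.
Proof.
move=> c0 Tc; split=> // x; rewrite !hsum_rnormE.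
rewrite -ler_sqr ?nnegrE ?mulr_ge0 ?hsum_norm_ge0// exprMn !hsum_norm_sqr.
rewrite /sqnorm mulr_sumr; apply: ler_sum => i _; rewrite -exprMn.
by rewrite ler_sqr ?nnegrE ?mulr_ge0 ?rnorm_ge0//; exact: (Tc i).2.
Qed.

Lemma bounded_by_le (V W : normedModType R[i]) (T : V -> W) (c d : R) :
  c <= d -> bounded_by T c -> bounded_by T d.
Proof.
move=> cd [c0 Tc]; split=> [|x]; first exact: le_trans cd.
by rewrite (le_trans (Tc x))// ler_wpM2r ?rnorm_ge0.
Qed.

Let max_opnorm T : R := \big[Num.max/0]_(i < n) opnorm (T i).

Let bounded_by_max_opnorm T : (forall i, bounded_operator (T i)) ->
  bounded_by (diag T) (max_opnorm T).
Proof.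
move=> bT; apply: bounded_by_diag => [|i]; first exact: bigmax_ge_id.
by apply: bounded_by_le (opnormP (bT i)); exact: le_bigmax.
Qed.

Lemma bounded_operator_diag T : (forall i, bounded_operator (T i)) ->
  bounded_operator (diag T).
Proof.
move=> bT; apply/bounded_operatorP; split.
  by apply: diag_linear => i; case: (bT i).
by exists (max_opnorm T); exact: bounded_by_max_opnorm.
Qed.

Lemma opnorm_diag_lt T e : (forall i, bounded_operator (T i)) -> 0 < e ->
  (forall i, opnorm (T i) < e) -> opnorm (diag T) < e.
Proof.
move=> bT e0 Te; apply: le_lt_trans (opnorm_le (bounded_by_max_opnorm bT)) _.
exact: bigmax_lt.
Qed.

Lemma opnorm_diag_ge T i : (forall i, bounded_operator (T i)) ->
  opnorm (T i) <= opnorm (diag T).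
Proof.
move=> bT; have bD := bounded_operator_diag bT.
apply: opnorm_le; split=> [|h]; first exact: opnorm_ge0.
have linT k : linear (T k) by case: (bT k).
rewrite -{1}(hsum_inj_same h) -[T i _]/(diag T (hsum_inj h) i).
rewrite (le_trans (hsum_norm_ge _ _))// -(rnorm_hsum_inj h) -hsum_rnormE.
exact: (opnormP bD).2.
Qed.

Lemma finite_rank_sum (V : hilbertType R) (I : Type) (s : seq I)
    (T : I -> V -> V) : (forall k, finite_rank (T k)) ->
  finite_rank (fun x => \sum_(k <- s) T k x).
Proof.
move=> fT; elim: s => [|k s [p [e pe]]].
  by exists 0%N, (fun=> 0) => x; exists (fun=> 0); rewrite big_nil big_ord0.
have [q [f qf]] := fT k.
exists (q + p)%N,
  (fun i => match fintype.split i with inl j => f j | inr j => e j end).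
move=> x; have [[c xc] [d xd]] := (qf x, pe x).
exists (fun i => match fintype.split i with inl j => c j | inr j => d j end).
rewrite big_cons xc xd big_split_ord/=; congr (_ + _); apply: eq_bigr => i _.
  by rewrite (unsplitK (inl i)).
by rewrite (unsplitK (inr i)).
Qed.

Lemma finite_rank_diag T : (forall i, linear (T i)) ->
  (forall i, finite_rank (T i)) -> finite_rank (diag T).
Proof.
move=> linT fT.
have -> : diag T = fun x : D => \sum_(i < n) hsum_inj (T i (x i)).
  by apply/funext => x; rewrite [LHS]hsum_decomposition.
apply: finite_rank_sum => i; have [p [e pe]] := fT i.
exists p, (fun k => hsum_inj (e k)) => x; have [c xc] := pe (x i); exists c.
rewrite xc (linear_sum _ _ (@hsum_inj_linear i)); apply: eq_bigr => k _.
exact: (linear_Z (@hsum_inj_linear i)).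
Qed.

Lemma projection_diag T : (forall i, projection (T i)) -> projection (diag T).
Proof.
move=> pT; split=> [||x y].
- by apply: bounded_operator_diag => i; have [bTi _ _] := pT i; exact: bTi.
- apply/funext => x; apply: hsumP => i.
  by case: (pT i) => _ TT _; exact: (congr1 (@^~ (x i)) TT).
- rewrite !hsum_innerE; apply: eq_bigr => i _.
  by have [_ _ adj] := pT i; exact: adj.
Qed.

End diagonal_operators.

(** * Direct sums of disjoint representations *)

Section representation_sum.
Context {R : realType} {A : cstarType R} {n : nat} {H : 'I_n -> hilbertType R}.
Variable sigma : forall i, A -> H i -> H i.
Arguments sigma : clear implicits.

Definition representation_sum (a : A) : hilbert_sum H -> hilbert_sum H :=
  diag (fun i => sigma i a).

Hypothesis sigma_rep : forall i, representation (sigma i).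

Lemma representation_sumP : representation representation_sum.
Proof.
split.
- move=> a; apply: bounded_operator_diag => i.
  by have [bsi _ _ _] := sigma_rep i; exact: bsi.
- move=> l a b; apply/funext => x; apply: hsumP => i.
  by case: (sigma_rep i) => _ lin _ _; exact: (congr1 (@^~ (x i)) (lin l a b)).
- move=> a b; apply/funext => x; apply: hsumP => i.
  by case: (sigma_rep i) => _ _ mul _; exact: (congr1 (@^~ (x i)) (mul a b)).
- move=> a x y; rewrite !hsum_innerE; apply: eq_bigr => i _.
  by have [_ _ _ adj] := sigma_rep i; exact: adj.
Qed.

Hypothesis sigma_disjoint : forall i j a, j != i ->
  exists b, sigma i b = sigma i a /\ forall h, sigma j b h = 0.

Variable P : forall i, H i -> H i.
Arguments P : clear implicits.
Hypothesis P_proj : forall i, projection (P i).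
Hypothesis P_bicomm : forall i, bicommutant (range (sigma i)) (P i).
Hypothesis P_null : forall i u, null_space (sigma i) u -> P i u = 0.

(** A matrix entry off the diagonal of an operator commuting with the sum has
    its range in one null space and kills the orthogonal complement of the
    other, so projections that vanish on the null spaces annihilate it on both
    sides. *)
Lemma bicommutant_diag : bicommutant (range representation_sum) (diag P).
Proof.
have linP i : linear (P i) by case: (P_proj i) => -[].
have lins i a : linear (sigma i a) by case: (sigma_rep i) => /(_ a)[].
split.
  by apply: bounded_operator_diag => i; have [bPi _ _] := P_proj i; exact: bPi.
move=> T [bT Tcomm]; have linT := bT.1.
have {}Tcomm a x : T (representation_sum a x) = representation_sum a (T x).
  by apply: (comp_eqP T (representation_sum a)).1; apply: Tcomm; exists a.
pose entry i j (h : H j) : H i := T (hsum_inj h) i.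
have entryl i j a (h : H j) : entry i j (sigma j a h) = sigma i a (entry i j h).
  rewrite /entry -[RHS]/(representation_sum a (T (hsum_inj h)) i) -Tcomm.
  by rewrite /representation_sum (diag_inj _ (fun i => lins i a)).
have lin_entry i j : linear (entry i j).
  by move=> l x y; rewrite /entry hsum_inj_linear linT.
have bdd_entry i j : bounded_by (entry i j) (opnorm T).
  have [c0 Tc] := opnormP bT; split=> // h; rewrite /entry.
  by rewrite (le_trans (hsum_norm_ge _ _))// -hsum_rnormE (le_trans (Tc _))//
    rnorm_hsum_inj.
have P_entry i j (h : H j) : P i (entry i j h) = entry i j (P j h).
  have [ij|ij] := eqVneq j i.
    subst j; apply: (comp_eqP (P i) (entry i i)).1.
    have [_] := P_bicomm i; apply; split.
      by apply/bounded_operatorP; split=> //; exists (opnorm T).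
    by move=> _ [a _ <-]; apply/comp_eqP => x; exact: entryl.
  rewrite P_null; last first.
    move=> a; have [b [<- b0]] := sigma_disjoint a ij.
    by rewrite -entryl b0 (linear_0 (lin_entry i j)).
  apply/esym; apply: (vanish_orthogonal_null_space (sigma_rep j)
    (lin_entry i j) (bdd_entry i j)).
    move=> a k; rewrite eq_sym in ij; have [b [<- b0]] := sigma_disjoint a ij.
    by rewrite entryl b0.
  move=> u Nu; have [_ _ adj] := P_proj j.
  by rewrite adj (P_null Nu) inner0r.
apply/comp_eqP => x; rewrite (hsum_decomposition x).
rewrite !(linear_sum _ _ linT) !(linear_sum _ _ (diag_linear linP)).
rewrite (linear_sum _ _ linT); apply: eq_bigr => j _.
rewrite (diag_inj _ linP); apply: hsumP => i; exact: P_entry.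
Qed.

End representation_sum.

(** * Sections with prescribed values *)

Section prescribed_values.
Context {R : realType} {X : topologicalType}.
Hypothesis X_lc : locally_compact [set: X].
Hypothesis X_hausdorff : hausdorff_space X.

Definition cutoff (t : X) (U : set X) (g : X -> R) : Prop :=
  [/\ continuous g, forall s, 0 <= g s <= 1, g t = 1,
      forall s, ~ U s -> g s = 0 &
      exists2 K, compact K & forall s, ~ K s -> g s = 0].

Lemma ex_cutoff t U : nbhs t U -> exists g, cutoff t U g.
Proof.
move=> Ut; have [K] := X_lc (x := t) I; rewrite withinET => Kt [cK _].
have UKt : (U `&` K)^° t by exact: filterI.
have clB : closed (~` (U `&` K)^°) by apply: open_closedC; exact: open_interior.
have us := @locally_compact_completely_regular X R X_lc X_hausdorff t _ clB
  (fun h => h UKt).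
have [f [cf f01 f0 f1]] := (@uniform_separatorP X R _ _).1 us.
have fB s : ~ (U `&` K) s -> f s = 1.
  by move=> nUK; apply: f1; exists s => // /interior_subset.
exists (fun s => 1 - f s); split.
- by move=> s; apply: cvgB; [exact: cvg_cst|exact: cf].
- move=> s; have /f01/= : range f (f s) by exists s.
  by rewrite in_itv/= => /andP[]; lra.
- by rewrite (_ : f t = 0) ?subr0//; apply: f0; exists t.
- by move=> s nU; rewrite fB ?subrr// => -[].
- by exists K => // s nK; rewrite fB ?subrr// => -[].
Qed.

Context {A : X -> cstarType R} (F : continuous_field A).

Lemma field_scale_continuous (g : X -> R) (x : forall t, A t) :
  continuous g -> field_section F x ->
  field_section F (fun t => (g t)%:C%C *: x t).
Proof.
move=> cg Fx; apply: field_local => t e e0.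
exists (fun s => (g t)%:C%C *: x s); first exact: fieldZ.
pose M := rnorm (x t) + 1.
have M0 : 0 < M by rewrite ltr_wpDl ?rnorm_ge0.
have xM : \forall s \near t, rnorm (x s) < M.
  have /cvgrPdist_lt/(_ 1 ltr01) := @field_continuous _ _ _ F x Fx t.
  by apply: filterS => s /=; rewrite distrC => /ltr_distlDr.
have gM : \forall s \near t, `|g t - g s| < e / M.
  by have /cvgrPdist_lt/(_ _ (divr_gt0 e0 M0)) := cg t.
apply: filterS2 xM gM => s /ltW xs /ltW gs.
rewrite -scalerBl -rmorphB rnorm_realZ distrC.
by rewrite (le_trans (ler_pM _ (rnorm_ge0 _) gs xs))// divfK// gt_eqF.
Qed.

Lemma ex_c0_cutoff t U g (x : forall t, A t) :
  cutoff t U g -> field_section F x ->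
  exists y : c0_section F, forall s, y s = (g s)%:C%C *: x s.
Proof.
move=> [cg _ _ _ [K cK Kg]] Fx.
have y0 : vanishes_at_infinity (fun s => (g s)%:C%C *: x s).
  by move=> e e0; exists K => // s /Kg ->; rewrite scale0r rnorm0.
by exists (C0Section (field_scale_continuous cg Fx) y0).
Qed.

Lemma c0_rnorm_ge (x : c0_section F) t : rnorm (x t) <= rnorm x.
Proof. exact: c0_norm_ge. Qed.

(** Cutting off near [t], where a section close to [a] at [t] has norm below
    [2 * rnorm a], controls the norm of the section on the whole space. *)
Lemma c0_section_approx t (a : A t) : exists x : c0_section F,
  rnorm (a - x t) <= 2^-1 * rnorm a /\ rnorm x <= 2 * rnorm a.
Proof.
have [a0|a0] := eqVneq (rnorm a) 0.
  exists 0; rewrite (_ : rnorm (0 : c0_section F) = 0) ?rnorm0//.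
  by rewrite -[(0 : c0_section F) t]/(0 : A t) subr0 a0 !mulr0.
have pa : 0 < rnorm a by rewrite lt_neqAle eq_sym a0 rnorm_ge0.
have d0 : 0 < 2^-1 * rnorm a by rewrite mulr_gt0// invr_gt0.
have [y Fy ay] : exists2 y, field_section F y &
    rnorm (a - y t) < 2^-1 * rnorm a.
  have nb : nbhs a (ball a (2^-1 * rnorm a)%:C%C).
    by apply: nbhsx_ballx; rewrite ltcR.
  have /(_ (ball a (2^-1 * rnorm a)%:C%C)^°) := @field_dense _ _ _ F t.
  case=> [||b [/interior_subset ab [y Fy yb]]].
  - by exists a.
  - exact: open_interior.
  - by exists y => //; move: ab; rewrite -yb -ball_normE/= rnormE ltcR.
have yt : rnorm (y t) < 2 * rnorm a.
  have := rnormD (y t - a) a; rewrite subrK rdistC; lra.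
have Ut : nbhs t [set s | rnorm (y s) < 2 * rnorm a].
  have /cvgrPdist_lt/(_ (2 * rnorm a - rnorm (y t))) :=
    @field_continuous _ _ _ F y Fy t.
  rewrite subr_gt0 => /(_ yt); apply: filterS => s /=.
  by rewrite distrC => /(le_lt_trans (ler_norm _)); rewrite ltrD2r.
have [g gU] := ex_cutoff Ut; have [x xE] := ex_c0_cutoff gU Fy.
have [_ g01 gt g0 _] := gU; exists x; split.
  by rewrite xE gt scale1r ltW.
rewrite c0_rnormE; apply: c0_norm_le => [|s]; first by rewrite mulr_ge0 ?ltW.
rewrite xE rnorm_realZ; have /andP[gs0 gs1] := g01 s; rewrite ger0_norm//.
have [Us|/g0 ->] := pselect (rnorm (y s) < 2 * rnorm a); last first.
  by rewrite mul0r mulr_ge0 ?ltW.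
by rewrite (le_trans _ (ltW Us))// ler_piMl ?rnorm_ge0.
Qed.

(** Successive approximation: the errors at [t] are halved at each step while
    the corrections have summable norms, so that completeness of the algebra of
    sections turns density of the values at [t] into equality. *)
Lemma c0_section_surjective t (a : A t) : exists x : c0_section F, x t = a.
Proof.
have [step stepP] := choice (@c0_section_approx t).
pose S := fix S k : c0_section F :=
  if k is k'.+1 then S k' + step (a - S k' t) else 0.
have err k : rnorm (a - S k t) <= rnorm a * 2^-1 ^+ k.
  elim: k => [|k IH].
    by rewrite -[S 0%N t]/(0 : A t) subr0 expr0 mulr1.
  rewrite -[S k.+1 t]/(S k t + step (a - S k t) t) opprD addrA.
  by rewrite (le_trans (stepP _).1)// exprS mulrCA ler_wpM2l ?invr_ge0.
have [x Sx] : exists x, tends_to S x.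
  apply: (@geometric_tends_to _ _ _ (2 * rnorm a)) => [|k].
    by rewrite mulr_ge0 ?rnorm_ge0.
  rewrite [S k.+1]/= addrC addKr (le_trans (stepP _).2)//.
  by rewrite -mulrA ler_wpM2l.
exists x; apply/eqP; rewrite -subr_eq0; apply/eqP/rnorm0_eq0.
apply/eqP; rewrite eq_le rnorm_ge0 andbT.
suff le_e (e : R) : 0 < e -> rnorm (x t - a) <= 0 + e by apply/ler_addgt0Pr.
move=> e0; have e20 : 0 < e / 2 by rewrite divr_gt0.
have [N xN] := Sx _ e20; have [M aM] := ex_geometric_lt (rnorm_ge0 a) e20.
rewrite add0r rdistC -(subrKA (S (maxn N M) t)) (le_trans (rnormD _ _))//.
rewrite [leRHS]splitr lerD//; last first.
  apply: le_trans (c0_rnorm_ge (S (maxn N M) - x) t) _.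
  by rewrite ltW// xN// leq_maxl.
rewrite (le_trans (err _))// (le_trans _ (ltW aM))// ler_wpM2l ?rnorm_ge0//.
by rewrite ler_wiXn2l ?invr_ge0 ?invf_le1 ?leq_maxr// ler1n.
Qed.

Lemma c0_section_prescribed (n : nat) (s : 'I_n -> X) (i : 'I_n) (a : A (s i)) :
  injective s ->
  exists x : c0_section F, x (s i) = a /\ forall j, j != i -> x (s j) = 0.
Proof.
move=> s_inj; have [x xa] := c0_section_surjective a.
have Us : nbhs (s i) [set u | forall j, j != i -> u != s j].
  apply: (@filter_forall X _ (fun j u => j != i -> u != s j) (nbhs (s i))) => j.
  have [->|ji] := eqVneq j i; first by apply: nearW.
  have cl1 : closed [set s j].
    exact/accessible_closed_set1/hausdorff_accessible.
  have : nbhs (s i) (~` [set s j]).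
    apply: open_nbhs_nbhs; split; first exact: closed_openC.
    by move=> /= /s_inj ij; rewrite ij eqxx in ji.
  by apply: filterS => u /= /eqP.
have [g gU] := ex_cutoff Us; have [y yE] := ex_c0_cutoff gU (c0_valP x).
have [_ _ gi g0 _] := gU; exists y; split; first by rewrite yE gi scale1r.
by move=> j ji; rewrite yE g0 ?scale0r// => /(_ j ji); rewrite eqxx.
Qed.

End prescribed_values.

(** * Assembling the fibers *)

Section assembling.
Context {R : realType} {X : topologicalType}.
Hypothesis X_lc : locally_compact [set: X].
Hypothesis X_hausdorff : hausdorff_space X.
Context {A : X -> cstarType R} (F : continuous_field A).

(** The first case accounts for the empty space, where no point is available. *)
Lemma c0_norm_nearly_attained (x : c0_section F) (e : R) : 0 < e ->
  rnorm x - e < 0 \/ exists t, rnorm x - e < rnorm (x t).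
Proof.
move=> e0; have [ex|nex] := pselect (exists t, rnorm x - e < rnorm (x t)).
  by right.
left; rewrite ltNge; apply/negP => xe0.
have : c0_norm x <= rnorm x - e.
  apply: c0_norm_le => // t; rewrite leNgt; apply/negP => xt.
  by apply: nex; exists t.
by rewrite -c0_rnormE lerBrDr gerDl leNgt e0.
Qed.

(** Pulling the representation of a fiber back along evaluation at [t] makes all
    fibers act through the same algebra, so that their sum is meaningful;
    [fm_local] remembers that only the values at [t] matter, and [fm_null] that
    the projection has been cut down to the essential part. *)
Record fiber_model (t : X) (n : nat) (x : 'I_n -> c0_section F) (e : R) := {
  fm_space : hilbertType R ;
  fm_rep : c0_section F -> fm_space -> fm_space ;
  fm_proj : fm_space -> fm_space ;
  fm_repP : representation (A := c0_algebra F) fm_rep ;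
  fm_local : forall y z : c0_section F, y t = z t -> fm_rep y = fm_rep z ;
  fm_projection : projection fm_proj ;
  fm_finite_rank : finite_rank fm_proj ;
  fm_bicommutant : bicommutant (range fm_rep) fm_proj ;
  fm_null : forall u, null_space (A := c0_algebra F) fm_rep u -> fm_proj u = 0 ;
  fm_commutator : forall j,
    opnorm ((fm_proj \o fm_rep (x j)) \- (fm_rep (x j) \o fm_proj)) < e ;
  fm_norm : forall j,
    rnorm (x j t) - e < opnorm (fm_proj \o fm_rep (x j) \o fm_proj)
}.

Lemma ex_fiber_model t n (x : 'I_n -> c0_section F) e :
  inner_quasidiagonal (A t) -> 0 < e -> exists M : fiber_model t x e, True.
Proof.
move=> iqd /(iqd n (fun j => x j t))[H [pi [P [pi_rep pP fP bP xP]]]].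
have [P' [pP' fP' bP' nP' eP']] := essential_cutdown pi_rep pP fP bP.
pose sigma (y : c0_section F) := pi (y t).
have range_sigma : range sigma = range pi.
  apply/seteqP; split=> _ [a _ <-]; first by exists (a t).
  by have [y <-] := c0_section_surjective X_lc X_hausdorff F a; exists y.
have [pi_bdd pi_lin pi_mul pi_star] := pi_rep.
have sigma_rep : representation (A := c0_algebra F) sigma.
  split=> [y|l y z|y z|y h k]; [exact: pi_bdd|exact: pi_lin|exact: pi_mul|].
  exact: pi_star.
have sigma_null u : null_space (A := c0_algebra F) sigma u -> P' u = 0.
  move=> su; apply: nP' => a.
  have [y <-] := c0_section_surjective X_lc X_hausdorff F a; exact: su.
unshelve eexists (@Build_fiber_model t n x e H sigma P' sigma_rep _ pP' fP' _
  sigma_null _ _) => //.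
- by move=> y z yz; rewrite /sigma yz.
- by rewrite range_sigma.
- move=> j; have [el er] := eP' (x j t); rewrite /sigma el er.
  exact: (xP j).1.
- move=> j; have [el er] := eP' (x j t); rewrite /sigma el -compA er.
  exact: (xP j).2.
Qed.

End assembling.

Arguments fm_rep {R X A F t n x e} f y h : rename.
Arguments fm_proj {R X A F t n x e} f h : rename.
Arguments fm_local {R X A F t n x e} f [y z] yz : rename.
Arguments fm_null {R X A F t n x e} f [u] Nu : rename.
Arguments fm_repP {R X A F t n x e} f.
Arguments fm_projection {R X A F t n x e} f.
Arguments fm_finite_rank {R X A F t n x e} f.
Arguments fm_bicommutant {R X A F t n x e} f.
Arguments fm_commutator {R X A F t n x e} f j : rename.
Arguments fm_norm {R X A F t n x e} f j : rename.

Theorem proposition6p2 (R : realType) (X : topologicalType)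
    (X_lc : locally_compact [set: X]) (X_hausdorff : hausdorff_space X)
    (A : X -> cstarType R) (F : continuous_field A)
    (A_separable : forall t : X, separable_space (A t))
    (A_iqd : forall t : X, inner_quasidiagonal (A t)) :
  inner_quasidiagonal (c0_algebra F).
Proof.
move=> n x e e0; have e20 : 0 < e / 2 by rewrite divr_gt0.
have peak j : exists t : option X,
    if t is Some t then rnorm (x j) - e / 2 < rnorm (x j t)
    else rnorm (x j) - e / 2 < 0.
  have [xj|[t xt]] := c0_norm_nearly_attained (x j) e20; first by exists None.
  by exists (Some t).
have [w wP] := choice peak.
(* Each point is taken once: repeated points would give equivalent summands,
   and the direct sum of the projections could leave the bicommutant. *)
pose pts := undup (pmap w (enum 'I_n)).
pose s (k : 'I_(size pts)) : X := tnth (in_tuple pts) k.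
have s_inj : injective s.
  by apply/tuple_uniqP; rewrite undup_uniq.
pose M k : fiber_model (s k) x (e / 2) :=
  sval (cid (ex_fiber_model X_lc X_hausdorff x (A_iqd (s k)) e20)).
pose sigma k := fm_rep (M k); pose P k := fm_proj (M k).
have sigma_rep k : representation (A := c0_algebra F) (sigma k) :=
  fm_repP (M k).
have P_proj k : projection (P k) := fm_projection (M k).
have bP k : bounded_operator (P k) by case: (P_proj k).
have bsigma k y : bounded_operator (sigma k y) by case: (sigma_rep k).
have disjoint i j (y : c0_algebra F) : j != i ->
    exists z : c0_algebra F, sigma i z = sigma i y /\ forall h, sigma j z h = 0.
  move=> ji; have [z [zi zj]] :=
    c0_section_prescribed X_lc X_hausdorff F (y (s i)) s_inj.
  exists z; split; first exact: fm_local.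
  move=> h; rewrite /sigma (fm_local (M j) (z := 0)) ?zj//.
  have [_ lin _ _] := sigma_rep j.
  exact: (congr1 (@^~ h) (linear_0 lin)).
exists (hilbert_sum (fun k => fm_space (M k))),
  (representation_sum sigma), (diag P).
split.
- exact: representation_sumP.
- exact: projection_diag.
- apply: finite_rank_diag => k; first by case: (bP k).
  exact: fm_finite_rank.
- apply: bicommutant_diag => // [k|k u]; first exact: fm_bicommutant.
  exact: fm_null.
move=> j; split.
  rewrite (_ : _ \- _ = diag (fun k =>
    (P k \o sigma k (x j)) \- (sigma k (x j) \o P k))) //.
  apply: opnorm_diag_lt => // k.
    by apply: bounded_operator_sub; exact: bounded_operator_comp.
  apply: lt_trans (fm_commutator (M k) j) _.
  by rewrite ltr_pdivrMr// ltr_pMr// ltr1n.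
rewrite (_ : _ \o _ = diag (fun k => P k \o sigma k (x j) \o P k)) //.
have bPsP k : bounded_operator (P k \o sigma k (x j) \o P k).
  by do 2 apply: bounded_operator_comp => //.
have := wP j; case wj : (w j) => [t|] xj; last first.
  apply: lt_le_trans (opnorm_ge0 (bounded_operator_diag bPsP)).
  by apply: le_lt_trans xj; rewrite lerD2l lerN2 ler_pdivrMr// ler_pMr// ler1n.
have tpts : t \in pts.
  by rewrite mem_undup mem_pmap -wj map_f// mem_enum.
have [k tk] : exists k, t = s k by apply/tnthP.
apply: lt_le_trans (opnorm_diag_ge k bPsP).
have := fm_norm (M k) j; rewrite -/(P k) -/(sigma k (x j)) => h.
apply: le_lt_trans h; rewrite tk in xj; move: xj.
by set a := rnorm (x j); set b := rnorm _; lra.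
Qed.
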